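(* Consider the one-sided test of $H_0:\boldsymbol\theta\le\mathbf 0$ versus $H_1:\boldsymbol\theta\not\le\mathbf 0$ under the conjugate encompassing prior $\pi(\boldsymbol\theta,\boldsymbol\gamma,\sigma^2)\propto N_{\boldsymbol\theta\mid\sigma^2}(\mathbf 0,\sigma^2\boldsymbol\Omega)\times\text{inv-}\chi^2_{\sigma^2}(s^2,\nu)$ (with flat prior for $\boldsymbol\gamma$). Then the posterior probability $P_\pi(\boldsymbol\theta\le\mathbf 0\mid\mathbf y)$ is bounded away from $0$ and $1$ for all $\mathbf y$ (uniformly: there are constants $0<a<b<1$ with $a\le P_\pi(\boldsymbol\theta\le\mathbf 0\mid\mathbf y)\le b$ for all $\mathbf y$). Hence the Bayes factor $B_{10}$ is information inconsistent. Moreover, if $\hat{\boldsymbol\theta}=c\,\boldsymbol v$ for a fixed vector $\boldsymbol v\neq\mathbf 0$ and $c\to\infty$, then $$P_\pi(\boldsymbol\theta\le\mathbf 0\mid\mathbf y)\to P(\boldsymbol\xi\le\mathbf 0),$$ where $\boldsymbol\xi$ has a multivariate Student $t$ distribution with mean $$\boldsymbol v^*=\frac{(\mathbf X_{\boldsymbol\theta}'\boldsymbol\Sigma^{-1}\mathbf X_{\boldsymbol\theta}+\boldsymbol\Omega^{-1})^{-1}\mathbf X_{\boldsymbol\theta}'\boldsymbol\Sigma^{-1}\mathbf X_{\boldsymbol\theta}\boldsymbol v}{(n+\nu-r_2)^{-1/2}\left(\boldsymbol v'\big((\mathbf X_{\boldsymbol\theta}'\boldsymbol\Sigma^{-1}\mathbf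 X_{\boldsymbol\theta})^{-1}+\boldsymbol\Omega\big)^{-1}\boldsymbol v\right)^{1/2}},$$ scale matrix $(\mathbf X_{\boldsymbol\theta}'\boldsymbol\Sigma^{-1}\mathbf X_{\boldsymbol\theta}+\boldsymbol\Omega^{-1})^{-1}$, and $n+\nu-r_2$ degrees of freedom.
   Context: Model: $\mathbf y=\mathbf X_{\boldsymbol\theta}\boldsymbol\theta+\mathbf X_{\boldsymbol\gamma}\boldsymbol\gamma+\boldsymbol\epsilon$, $\boldsymbol\epsilon\sim N(\mathbf 0,\sigma^2\boldsymbol\Sigma)$, with $\mathbf y\in\mathbb R^n$, $\boldsymbol\theta\in\mathbb R^{r_1}$ ($r_1\ge1$) the tested parameters, $\boldsymbol\gamma\in\mathbb R^{r_2}$ ($r_2\ge0$) nuisance parameters, $n>r_1+r_2$, $\boldsymbol\Sigma$ a known positive definite matrix, $[\mathbf X_{\boldsymbol\theta}\ \mathbf X_{\boldsymbol\gamma}]$ of full column rank, and $\mathbf X_{\boldsymbol\theta}'\boldsymbol\Sigma^{-1}\mathbf X_{\boldsymbol\gamma}=\mathbf 0$. $\hat{\boldsymbol\theta}=(\mathbf X_{\boldsymbol\theta}'\boldsymbol\Sigma^{-1}\mathbf X_{\boldsymbol\theta})^{-1}\mathbf X_{\boldsymbol\theta}'\boldsymbol\Sigma^{-1}\mathbf y$ is the ML estimate and $s_{\mathbf y}^2=(\mathbf y-\mathbf X_{\boldsymbol\theta}\hat{\boldsymbol\theta}-\mathbf X_{\boldsymbol\gamma}\hat{\boldsymbol\gamma})'\boldsymbol\Sigma^{-1}(\mathbf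 y-\mathbf X_{\boldsymbol\theta}\hat{\boldsymbol\theta}-\mathbf X_{\boldsymbol\gamma}\hat{\boldsymbol\gamma})$, which is taken to be positive. Inequalities between vectors are coordinatewise; $\boldsymbol\theta\not\le\mathbf 0$ means at least one coordinate is positive; $\boldsymbol\Theta_0=\{\boldsymbol\theta\le\mathbf 0\}$, $\boldsymbol\Theta_1=\{\boldsymbol\theta\not\le\mathbf 0\}$. $\boldsymbol\Omega$ is positive definite, $\nu\ge0$, $s>0$; $\text{inv-}\chi^2(s^2,\nu)$ has density proportional to $(\sigma^2)^{-\nu/2-1}e^{-\nu s^2/(2\sigma^2)}$, with $\nu=0$ denoting the improper prior $\sigma^{-2}$. Under $H_t$ ($t=0,1$) the prior is the encompassing prior with $\boldsymbol\theta\mid\sigma^2$ truncated to $\boldsymbol\Theta_t$ and renormalized by $P_\pi(\boldsymbol\theta\in\boldsymbol\Theta_t\mid\sigma^2)$ (which does not depend on $\sigma^2$), and the same priors for $\boldsymbol\gamma,\sigma^2$. The Bayes factor then equals $$B_{10}=\left(P_\pi(\boldsymbol\theta\le\mathbf 0\mid\sigma^2=1)^{-1}-1\right)^{-1}\left(P_\pi(\boldsymbol\theta\le\mathbf 0\mid\mathbf y)^{-1}-1\right),$$ where $P_\pi(\cdot\mid\mathbf y)$ is the posterior under the encompassing prior. Definition: the Bayes factor for the one-sided test is information consistent if $B_{10}\to\infty$ as $|\hat{\boldsymbol\theta}|\to\infty$ with at least one coordinate of $\hat{\boldsymbol\theta}$ going to $\infty$, and $B_{10}\to0$ as all coordinates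 of $\hat{\boldsymbol\theta}$ go to $-\infty$; otherwise it is information inconsistent. In the limit $c\to\infty$, all quantities other than $\hat{\boldsymbol\theta}$ (including $s_{\mathbf y}^2$) are held fixed. *)

(* Defs.v *)
From HB Require Import structures.
From mathcomp Require Import all_boot all_order all_algebra.
From mathcomp Require Import all_classical all_reals all_analysis.
Import Order.TTheory GRing.Theory Num.Theory.
Import numFieldNormedType.Exports.

Set Implicit Arguments.
Unset Strict Implicit.
Unset Printing Implicit Defensive.

Local Open Scope classical_set_scope.
Local Open Scope ring_scope.

(* Vectors of R^p are columns 'cV[R]_p; r2 = 0 (no nuisance parameter) is the
   case of matrices with no columns. *)

(* Lebesgue integral over R^p, as an iterated one-dimensional integral. By
   Tonelli, for non-negative measurable f (the only integrands below) it is the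
   integral against p-dimensional Lebesgue measure. For p = 0 it is evaluation
   at the only point. *)
Fixpoint integral_cV (R : realType) (p : nat) :
    ('cV[R]_p -> \bar R) -> \bar R :=
  match p with
  | 0%N => fun f => f 0
  | p'.+1 => fun f =>
      (\int[lebesgue_measure]_x
         integral_cV (fun v : 'cV[R]_p' => f (col_mx (x%:M : 'M[R]_1) v)))%E
  end.

Definition qform (R : realType) (p : nat) (S : 'M[R]_p) (x : 'cV[R]_p) : R :=
  (x^T *m S *m x) ord0 ord0.

Definition posdef (R : realType) (p : nat) (S : 'M[R]_p) : Prop :=
  S^T = S /\ forall x : 'cV[R]_p, x != 0 -> 0 < qform S x.

Definition enorm (R : realType) (p : nat) (x : 'cV[R]_p) : R :=
  Num.sqrt (\sum_(i < p) x i ord0 ^+ 2).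

Definition Theta0 (R : realType) (p : nat) : set 'cV[R]_p :=
  [set x | forall i, x i ord0 <= 0].

Definition Theta1 (R : realType) (p : nat) : set 'cV[R]_p :=
  [set x | exists i, 0 < x i ord0].

Definition mvnormal_pdf (R : realType) (p : nat) (mu : 'cV[R]_p) (S : 'M[R]_p)
    (x : 'cV[R]_p) : R :=
  expR (- (qform (invmx S) (x - mu) / 2)) / Num.sqrt ((2 * pi) ^+ p * \det S).

(* Unnormalised density of inv-chi^2(s2, nu); for nu = 0 it is the improper
   prior sig2^-1. *)
Definition inv_chi2_kernel (R : realType) (s2 nu sig2 : R) : R :=
  sig2 `^ (- (nu / 2) - 1) * expR (- (nu * s2 / (2 * sig2))).

(* Unnormalised density of the p-variate Student t distribution with k degrees
   of freedom, location mu (the mean, as soon as k > 1) and scale matrix S. *)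
Definition mvstudent_kernel (R : realType) (p : nat) (k : R) (mu : 'cV[R]_p)
    (S : 'M[R]_p) (x : 'cV[R]_p) : R :=
  (1 + qform (invmx S) (x - mu) / k) `^ (- ((k + p%:R) / 2)).

Definition mvstudent_prob (R : realType) (p : nat) (k : R) (mu : 'cV[R]_p)
    (S : 'M[R]_p) (A : set 'cV[R]_p) : R :=
  fine (integral_cV (fun x => (mvstudent_kernel k mu S x * \1_A x)%:E)) /
  fine (integral_cV (fun x => (mvstudent_kernel k mu S x)%:E)).

(* The known quantities other than the data: design matrices, error covariance
   Sigma (up to sigma^2), and the prior hyperparameters Omega, s, nu. *)
Record model (R : realType) (n r1 r2 : nat) := Model {
  Xtheta : 'M[R]_(n, r1);
  Xgamma : 'M[R]_(n, r2);
  Sigma : 'M[R]_n;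
  Omega : 'M[R]_r1;
  s_prior : R;
  nu_prior : R }.

Record model_assumptions (R : realType) (n r1 r2 : nat)
    (M : model R n r1 r2) : Prop := ModelAssumptions {
  r1_ge1 : (1 <= r1)%N;
  n_large : (r1 + r2 < n)%N;
  Sigma_posdef : posdef (Sigma M);
  X_full_column_rank : \rank (row_mx (Xtheta M) (Xgamma M)) = (r1 + r2)%N;
  X_orthogonal : (Xtheta M)^T *m invmx (Sigma M) *m Xgamma M = 0;
  Omega_posdef : posdef (Omega M);
  s_prior_gt0 : 0 < s_prior M;
  nu_prior_ge0 : 0 <= nu_prior M }.

Definition gls (R : realType) (n r : nat) (S : 'M[R]_n) (X : 'M[R]_(n, r))
    (y : 'cV[R]_n) : 'cV[R]_r :=
  invmx (X^T *m invmx S *m X) *m (X^T *m invmx S *m y).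

Section OneSidedTest.
Context (R : realType) (n r1 r2 : nat) (M : model R n r1 r2).

Definition theta_hat (y : 'cV[R]_n) : 'cV[R]_r1 := gls (Sigma M) (Xtheta M) y.

Definition gamma_hat (y : 'cV[R]_n) : 'cV[R]_r2 := gls (Sigma M) (Xgamma M) y.

Definition s2_y (y : 'cV[R]_n) : R :=
  qform (invmx (Sigma M))
    (y - Xtheta M *m theta_hat y - Xgamma M *m gamma_hat y).

Definition likelihood (y : 'cV[R]_n) (theta : 'cV[R]_r1) (gamma : 'cV[R]_r2)
    (sig2 : R) : R :=
  mvnormal_pdf (Xtheta M *m theta + Xgamma M *m gamma) (sig2 *: Sigma M) y.

(* The encompassing prior, possibly improper, with flat prior for gamma. *)
Definition prior_theta (sig2 : R) (theta : 'cV[R]_r1) : R :=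
  mvnormal_pdf 0 (sig2 *: Omega M) theta.

Definition prior (theta : 'cV[R]_r1) (gamma : 'cV[R]_r2) (sig2 : R) : R :=
  prior_theta sig2 theta *
  inv_chi2_kernel (s_prior M ^+ 2) (nu_prior M) sig2.

Definition prior_prob (A : set 'cV[R]_r1) (sig2 : R) : R :=
  fine (integral_cV (fun theta => (prior_theta sig2 theta * \1_A theta)%:E)).

Definition truncated_prior (A : set 'cV[R]_r1) (theta : 'cV[R]_r1)
    (gamma : 'cV[R]_r2) (sig2 : R) : R :=
  prior theta gamma sig2 * \1_A theta / prior_prob A sig2.

Definition integral_params (f : 'cV[R]_r1 -> 'cV[R]_r2 -> R -> R) : R :=
  fine (\int[lebesgue_measure]_(sig2 in (`]0%R, +oo[%classic : set R))
          integral_cV (fun gamma : 'cV[R]_r2 =>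
            integral_cV (fun theta : 'cV[R]_r1 =>
              (f theta gamma sig2)%:E)))%E.

Definition posterior_prob (y : 'cV[R]_n) (A : set 'cV[R]_r1) : R :=
  integral_params (fun theta gamma sig2 =>
    likelihood y theta gamma sig2 * prior theta gamma sig2 * \1_A theta) /
  integral_params (fun theta gamma sig2 =>
    likelihood y theta gamma sig2 * prior theta gamma sig2).

Definition marginal_likelihood (A : set 'cV[R]_r1) (y : 'cV[R]_n) : R :=
  integral_params (fun theta gamma sig2 =>
    likelihood y theta gamma sig2 * truncated_prior A theta gamma sig2).

Definition bayes_factor10 (y : 'cV[R]_n) : R :=
  marginal_likelihood (@Theta1 R r1) y / marginal_likelihood (@Theta0 R r1) y.

(* Along the data sets y_0, y_1, ... only theta_hat varies. *)
Definition only_theta_hat_varies (y : nat -> 'cV[R]_n) : Prop :=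
  0 < s2_y (y 0%N) /\
  forall k, s2_y (y k) = s2_y (y 0%N) /\ gamma_hat (y k) = gamma_hat (y 0%N).

Definition information_consistent : Prop :=
  (forall y : nat -> 'cV[R]_n, only_theta_hat_varies y ->
     enorm (theta_hat (y k)) @[k --> \oo] --> +oo ->
     (exists i, theta_hat (y k) i ord0 @[k --> \oo] --> +oo) ->
     bayes_factor10 (y k) @[k --> \oo] --> +oo) /\
  (forall y : nat -> 'cV[R]_n, only_theta_hat_varies y ->
     (forall i, theta_hat (y k) i ord0 @[k --> \oo] --> -oo) ->
     bayes_factor10 (y k) @[k --> \oo] --> (0 : R)).

Definition information_inconsistent : Prop := ~ information_consistent.

Definition theta_precision : 'M[R]_r1 :=
  (Xtheta M)^T *m invmx (Sigma M) *m Xtheta M.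

Definition limit_df : R := n%:R + nu_prior M - r2%:R.

Definition limit_scale : 'M[R]_r1 :=
  invmx (theta_precision + invmx (Omega M)).

Definition limit_mean (v : 'cV[R]_r1) : 'cV[R]_r1 :=
  (limit_df `^ (- 2^-1) *
   Num.sqrt (qform (invmx (invmx theta_precision + Omega M)) v))^-1 *:
  (limit_scale *m theta_precision *m v).

End OneSidedTest.

(* Main.v *)
Require Import Defs.
From HB Require Import structures.
From mathcomp Require Import all_boot all_order all_algebra.
From mathcomp Require Import all_classical all_reals all_analysis.
From mathcomp Require Import measurable_realfun.
From mathcomp Require Import ring lra zify.
Import Order.TTheory GRing.Theory Num.Theory.
Import numFieldNormedType.Exports.

Set Implicit Arguments.
Unset Strict Implicit.
Unset Printing Implicit Defensive.

Local Open Scope classical_set_scope.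
Local Open Scope ring_scope.

(** Why the statement holds.  Integrating gamma and sigma^2 out of the joint
    density leaves a multivariate Student posterior for theta, whose squared
    scale is proportional to
      D(y) = s_y^2 + nu s^2 + theta_hat' (A^-1 + Omega)^-1 theta_hat
    and whose location is m(y) = P^-1 A theta_hat, where A is the precision of
    theta_hat and P = A + Omega^-1.  The sets theta <= 0 and
    its complement are cones, so rescaling theta by (D / k)^(1/2), with k the
    degrees of freedom, does not change their probabilities.  What results is
    an exact identity (posterior_probE): the posterior probability of a cone is
    its probability under the Student distribution with k degrees of freedom,
    the fixed scale matrix P^-1 and the location mu(y) = (D / k)^(-1/2) m(y).
    The data act through mu(y) alone.

    As theta_hat grows, D grows as fast as |m|^2, so mu(y) remains in a bounded
    set (shift_factor_loc_le).  If theta_hat = c v, then mu(y) is a multiple of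
    one fixed vector, and it converges to v* as c goes to infinity
    (cvg_scaled_ratio, limit_meanE).

    It remains to see how a Student probability depends on its location.  Two
    Student kernels that differ only in the location are comparable pointwise,
    up to a factor that depends only on the distance between the locations and
    tends to 1 with it (student_shift_le, student_kernel_shift_le).  Integrated
    over any set, this comparison gives continuity in the location, hence the
    limit (cvg_mvstudent_prob); and comparison with the location 0 gives bounds
    away from 0 and 1 that are uniform over bounded locations
    (posterior_bounds).

    The prior probability of a cone does not depend on sigma^2, so B_10 is a
    constant multiple of the posterior odds (bayes_factorE).  It is thus bounded
    below by a positive number.  Data with a fixed residual and all coordinates
    of theta_hat going to minus infinity exist because n > r1 + r2, and along
    them B_10 cannot go to 0: this is the inconsistency.

    The integrals over R^p are iterated one-dimensional integrals, so
    linearity, Tonelli's theorem and affine changes of variables are obtained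
    by induction on the dimension. *)

(** * Positive definite quadratic forms *)

Section QuadraticForms.
Context {R : realType}.

Definition bform p (S : 'M[R]_p) (x y : 'cV[R]_p) : R :=
  (x^T *m S *m y) ord0 ord0.

Lemma trZ m n (a : R) (A : 'M[R]_(m, n)) : (a *: A)^T = a *: A^T.
Proof. by rewrite linearZ. Qed.

Lemma trD m n (A B : 'M[R]_(m, n)) : (A + B)^T = A^T + B^T.
Proof. by rewrite linearD. Qed.

Lemma qformZ p (S : 'M[R]_p) a x : qform S (a *: x) = a ^+ 2 * qform S x.
Proof.
by rewrite /qform trZ -scalemxAr -!scalemxAl 2!mxE mulrA expr2.
Qed.

Lemma qformZl p (S : 'M[R]_p) a x : qform (a *: S) x = a * qform S x.
Proof. by rewrite /qform -scalemxAr -scalemxAl mxE. Qed.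

Lemma qform0 p (S : 'M[R]_p) : qform S 0 = 0.
Proof. by rewrite /qform mulmx0 mxE. Qed.

Lemma qformDl p (S T : 'M[R]_p) x : qform (S + T) x = qform S x + qform T x.
Proof. by rewrite /qform mulmxDr mulmxDl mxE. Qed.

Lemma qform_mulmx p q (S : 'M[R]_p) (B : 'M[R]_(p, q)) x :
  qform S (B *m x) = qform (B^T *m S *m B) x.
Proof. by rewrite /qform trmx_mul !mulmxA. Qed.

Lemma trmx11 (a : 'M[R]_1) : a^T = a.
Proof. by apply/matrixP => i j; rewrite mxE !ord1. Qed.

Lemma bformC p (S : 'M[R]_p) x y : S^T = S -> bform S x y = bform S y x.
Proof.
move=> sS; rewrite /bform; congr (fun_of_matrix _ ord0 ord0).
by rewrite -[LHS]trmx11 !trmx_mul trmxK sS mulmxA.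
Qed.

Lemma qformD p (S : 'M[R]_p) x y : S^T = S ->
  qform S (x + y) = qform S x + 2 * bform S x y + qform S y.
Proof.
move=> sS.
have addE (A B : 'M[R]_1) : (A + B) ord0 ord0 = A ord0 ord0 + B ord0 ord0.
  by rewrite mxE.
rewrite /qform trD !mulmxDl !mulmxDr !addE.
rewrite -/(bform S x y) -/(bform S y x) (bformC y x sS).
ring.
Qed.

Lemma bformZr p (S : 'M[R]_p) x a y : bform S x (a *: y) = a * bform S x y.
Proof. by rewrite /bform -scalemxAr mxE. Qed.

Lemma posdef_ge0 p (S : 'M[R]_p) x : posdef S -> 0 <= qform S x.
Proof.
move=> [_ S0]; have [->|x0] := eqVneq x 0; first by rewrite qform0.
exact/ltW/S0.
Qed.

Lemma posdef_unitmx p (S : 'M[R]_p) : posdef S -> S \in unitmx.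
Proof.
move=> [sS S0]; rewrite -row_free_unit -kermx_eq0; apply: contraT.
move=> /rowV0Pn[v /sub_kermxP vS v0].
have /S0 : v^T != 0 by rewrite -[0](trmx0) (inj_eq trmx_inj).
by rewrite /qform trmxK vS mul0mx mxE ltxx.
Qed.

Lemma posdefD p (S T : 'M[R]_p) : posdef S -> posdef T -> posdef (S + T).
Proof.
move=> [sS S0] [sT T0]; split; first by rewrite trD sS sT.
by move=> x x0; rewrite qformDl addr_gt0 ?S0 ?T0.
Qed.

Lemma posdefZ p (S : 'M[R]_p) a : 0 < a -> posdef S -> posdef (a *: S).
Proof.
move=> a0 [sS S0]; split; first by rewrite trZ sS.
by move=> x x0; rewrite qformZl mulr_gt0 ?S0.
Qed.

Lemma posdef_congr p q (S : 'M[R]_p) (B : 'M[R]_(p, q)) :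
  posdef S -> \rank B = q -> posdef (B^T *m S *m B).
Proof.
move=> [sS S0] rB; split; first by rewrite !trmx_mul trmxK sS mulmxA.
move=> x x0; rewrite -qform_mulmx; apply: S0; apply: contra_neq x0 => Bx0.
have fB : row_free B^T by rewrite /row_free mxrank_tr rB.
apply: trmx_inj; apply: (row_free_inj fB).
by rewrite -trmx_mul Bx0 !trmx0 mul0mx.
Qed.

Lemma posdef_invmx p (S : 'M[R]_p) : posdef S -> posdef (invmx S).
Proof.
move=> pS; have uS := posdef_unitmx pS.
rewrite (_ : invmx S = (invmx S)^T *m S *m invmx S).
  by apply: posdef_congr => //; rewrite mxrank_unit ?unitmx_inv.
by rewrite trmx_inv (proj1 pS) mulVmx// mul1mx.
Qed.

(** Positivity of the determinant is what makes the normalising constants of the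
    normal densities positive numbers.  Induction on the dimension: the determinant
    of S is its first entry times the determinant of the Schur complement, which is
    again positive definite. *)
Lemma posdef_det_gt0 p (S : 'M[R]_p) : posdef S -> 0 < \det S.
Proof.
elim: p S => [|p IH] S pS; first by rewrite det_mx00.
change (0 < \det (S : 'M[R]_(1 + p))).
have [sS S0] : posdef (S : 'M[R]_(1 + p)) := pS.
set S1 := (S : 'M[R]_(1 + p)) in sS S0 *.
pose a := ulsubmx S1; pose b := ursubmx S1.
pose D := drsubmx S1.
have SE : S1 = block_mx a b b^T D.
  rewrite -[LHS]submxK; congr block_mx.
  by rewrite /b trmx_ursub sS.
have aE : a = (a ord0 ord0)%:M by exact: mx11_scalar.
set t := a ord0 ord0 in aE.
have t0 : 0 < t.
  have := S0 (col_mx 1%:M 0 : 'cV[R]_(1 + p)).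
  rewrite /qform tr_col_mx SE mul_row_block !trmx0 !mul0mx.
  rewrite !addr0 tr_scalar_mx !mul1mx mul_row_col mulmx0 addr0 mulmx1; apply.
  apply/eqP => /(congr1 usubmx); rewrite col_mxKu.
  by move/matrixP => /(_ ord0 ord0); rewrite !mxE eqxx => /eqP; rewrite oner_eq0.
pose D' := D - t^-1 *: (b^T *m b).
(* Block elimination of the first column. *)
have -> : \det S1 = t * \det D'.
  rewrite (_ : S1 = (block_mx 1%:M 0 (t^-1 *: b^T) 1%:M : 'M[R]_(1 + p)) *m
                   (block_mx a b 0 D' : 'M[R]_(1 + p))).
    by rewrite det_mulmx det_lblock det_ublock !det1 !mul1r aE det_scalar1.
  rewrite mulmx_block !mul1mx !mul0mx !addr0.
  rewrite -!scalemxAl aE mul_mx_scalar scalerA mulVf ?gt_eqF// scale1r.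
  by rewrite /D' addrC subrK -aE.
rewrite mulr_gt0// IH//; split.
  rewrite /D' linearB /= trZ trmx_mul trmxK; congr (_ - _).
  by rewrite /D trmx_drsub sS.
move=> y y0.
(* The form of the Schur complement at y is the form of S at the vector that
   extends y and minimises the form of S among all such extensions. *)
have := S0 (col_mx (- t^-1 *: (b *m y)) y : 'cV[R]_(1 + p)).
have -> : qform S1 (col_mx (- t^-1 *: (b *m y)) y : 'cV[R]_(1 + p)) = qform D' y.
  rewrite /qform tr_col_mx SE mul_row_block mul_row_col.
  have uT : (- t^-1 *: (b *m y))^T = - t^-1 *: (y^T *m b^T).
    by rewrite trZ trmx_mul.
  have -> : (- t^-1 *: (b *m y))^T *m a + y^T *m b^T = 0.
    rewrite uT aE mul_mx_scalar scalerA mulrN mulfV ?gt_eqF// scaleN1r.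
    by rewrite addNr.
  rewrite mul0mx add0r uT; congr (fun_of_matrix (_ *m y) _ _).
  by rewrite mulmxBr -scalemxAr -scalemxAl scaleNr mulmxA addrC.
apply; apply: contra_neq y0 => /(congr1 (@dsubmx _ 1 p 1)).
by rewrite col_mxKd => ->; apply/matrixP => i j; rewrite !mxE.
Qed.

Lemma cauchy_schwarz_posdef p (S : 'M[R]_p) x y : posdef S ->
  bform S x y ^+ 2 <= qform S x * qform S y.
Proof.
move=> pS; have [->|x0] := eqVneq x 0.
  by rewrite qform0 mul0r /bform trmx0 !mul0mx mxE expr0n.
have qx : 0 < qform S x by apply: (proj2 pS).
have := posdef_ge0 (y - (bform S x y / qform S x) *: x) pS.
rewrite -scaleNr qformD ?(proj1 pS)// qformZ bformZr (bformC y x (proj1 pS)).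
set b := bform S x y; set qy := qform S y.
rewrite (_ : qy + _ + _ = (qform S x * qy - b ^+ 2) / qform S x); last first.
  by field; rewrite gt_eqF.
by rewrite pmulr_lge0 ?invr_gt0// subr_ge0.
Qed.

(** Cauchy-Schwarz for the form of S, applied to x and to the vector that S maps to
    the i-th basis vector, bounds x_i^2 by (S^-1)_ii times the form at x. *)
Lemma posdef_coord_le p (S : 'M[R]_p) : posdef S ->
  exists2 c : R, 0 < c & forall (x : 'cV[R]_p) i, x i ord0 ^+ 2 <= c * qform S x.
Proof.
move=> pS; have uS := posdef_unitmx pS.
have dE i : qform S (invmx S *m delta_mx i ord0) = invmx S i i.
  rewrite qform_mulmx trmx_inv (proj1 pS) mulVmx// mul1mx /qform trmx_delta.
  by rewrite -rowE -colE !mxE.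
have d0 i : 0 <= invmx S i i by rewrite -dE posdef_ge0.
exists (1 + \sum_i invmx S i i); first by rewrite ltr_wpDr// sumr_ge0.
move=> x i.
have := cauchy_schwarz_posdef (invmx S *m delta_mx i ord0) x pS.
rewrite dE.
have -> : bform S (invmx S *m delta_mx i ord0) x = x i ord0.
  rewrite /bform trmx_mul trmx_inv (proj1 pS) -!mulmxA mulKmx//.
  by rewrite trmx_delta -rowE mxE.
move/le_trans; apply; rewrite ler_wpM2r ?posdef_ge0//.
rewrite (bigD1 i)//= addrCA lerDl addr_ge0//.
by apply: sumr_ge0 => j _.
Qed.

Lemma qform_sum p (S : 'M[R]_p) x :
  qform S x = \sum_j \sum_k x k ord0 * S k j * x j ord0.
Proof.
rewrite /qform mxE; apply: eq_bigr => j _; rewrite mxE mulr_suml.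
by apply: eq_bigr => k _; rewrite mxE.
Qed.

Lemma qform_le_coord p (S : 'M[R]_p) (x : 'cV[R]_p) (B : R) :
  (forall i, x i ord0 ^+ 2 <= B) ->
  qform S x <= (\sum_j \sum_k `|S k j|) * B.
Proof.
move=> xB; rewrite qform_sum mulr_suml; apply: ler_sum => j _.
rewrite mulr_suml; apply: ler_sum => k _.
apply: (le_trans (ler_norm _)); rewrite !normrM mulrAC mulrC.
rewrite ler_wpM2l//.
have := xB j; have := xB k.
rewrite -(real_normK (num_real (x k ord0))) -(real_normK (num_real (x j ord0))).
set u := `|x k ord0|; set v := `|x j ord0| => hu hv.
have := sqr_ge0 (u - v); rewrite sqrrB; nra.
Qed.

(** Equivalence of quadratic forms in finite dimension, without compactness of the
    sphere: both forms are compared with the squares of the coordinates. *)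
Lemma qform_le_posdef p (S T : 'M[R]_p) : posdef S ->
  exists2 c : R, 0 < c & forall x, qform T x <= c * qform S x.
Proof.
move=> /[dup] pS /posdef_coord_le [c c0 hc].
set t := \sum_j \sum_k `|T k j|.
have t0 : 0 <= t by apply: sumr_ge0 => j _; apply: sumr_ge0.
exists (t * c + 1); first by rewrite ltr_wpDl// mulr_ge0// ltW.
move=> x; apply: (@le_trans _ _ (t * (c * qform S x))).
  by apply: qform_le_coord => i; exact: hc.
by rewrite mulrA ler_wpM2r ?posdef_ge0// lerDl.
Qed.

(** Reduces the integrability of a function of a quadratic form on R^p to that of
    1 / (1 + x^2) on the line. *)
Lemma prod_oneDsqr_le p (S : 'M[R]_p) : posdef S ->
  exists2 c : R, 0 < c & forall x : 'cV[R]_p,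
    \prod_i oneDsqr (x i ord0) <= (c * (1 + qform S x)) ^+ p.
Proof.
move=> /[dup] pS /posdef_coord_le [c c0 hc]; exists (1 + c) => [|x].
  by rewrite addr_gt0.
have q0 := posdef_ge0 x pS.
rewrite -[X in _ <= X](_ : \prod_(i < p) ((1 + c) * (1 + qform S x)) = _);
  last by rewrite prodr_const card_ord.
apply: ler_prod => i _.
rewrite /oneDsqr addr_ge0 ?sqr_ge0//=.
have := hc x i; nra.
Qed.

(** With N the norm sqrt (q / k), this is
    1 + (N a + N b)^2 <= (1 + N b)^2 (1 + (N a)^2), which follows from
    2 N a <= 1 + (N a)^2.  The factor depends on the shift b only, and it is 1 for
    b = 0; both facts are essential for the way it is used. *)
Lemma student_shift_le p (S : 'M[R]_p) (k : R) (a b : 'cV[R]_p) :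
  0 < k -> posdef S ->
  1 + qform S (a + b) / k <=
  (1 + Num.sqrt (qform S b / k)) ^+ 2 * (1 + qform S a / k).
Proof.
move=> k0 pS; rewrite qformD ?(proj1 pS)//.
have qa := posdef_ge0 a pS; have qb := posdef_ge0 b pS.
have ha : 0 <= qform S a / k by rewrite divr_ge0// ltW.
have hb : 0 <= qform S b / k by rewrite divr_ge0// ltW.
set u := Num.sqrt (qform S a / k); set v := Num.sqrt (qform S b / k).
have u0 : 0 <= u := sqrtr_ge0 _; have v0 : 0 <= v := sqrtr_ge0 _.
have uE : u ^+ 2 = qform S a / k by rewrite sqr_sqrtr.
have vE : v ^+ 2 = qform S b / k by rewrite sqr_sqrtr.
have bE : bform S a b / k <= u * v.
  apply: (le_trans (ler_norm _)); rewrite -sqrtr_sqr /u /v -sqrtrM//.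
  rewrite ler_wsqrtr// expr_div_n mulf_div -expr2 ler_wpM2r//.
    by rewrite invr_ge0 sqr_ge0.
  exact: cauchy_schwarz_posdef.
rewrite !mulrDl -uE -vE -mulrA.
have := sqr_ge0 (u - 1); rewrite sqrrB; nra.
Qed.

Lemma rank_row_mx_full m p q (A : 'M[R]_(m, p)) (B : 'M[R]_(m, q)) :
  \rank (row_mx A B) = (p + q)%N -> \rank A = p /\ \rank B = q.
Proof.
move=> h.
have le : (p + q <= \rank A + \rank B)%N.
  rewrite -h -mxrank_tr tr_row_mx -addsmxE -[\rank A]mxrank_tr -[\rank B]mxrank_tr.
  exact: mxrank_adds_leqif.
have := rank_leq_col A; have := rank_leq_col B; lia.
Qed.

(** Completing the square in theta.  The constant term comes from the Woodbury
    identity A - A P^-1 A = (A^-1 + Omega)^-1. *)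
Lemma complete_square p (A Om : 'M[R]_p) (t h : 'cV[R]_p) :
  posdef A -> posdef Om ->
  let P := A + invmx Om in
  qform A (t - h) + qform (invmx Om) t =
  qform P (t - invmx P *m A *m h) + qform (invmx (invmx A + Om)) h.
Proof.
move=> pA pO P.
have pP : posdef P by apply: posdefD => //; exact: posdef_invmx.
have pH : posdef (invmx A + Om) by apply: posdefD => //; exact: posdef_invmx.
have [uA uO uP uH] : [/\ A \in unitmx, Om \in unitmx, P \in unitmx &
    invmx A + Om \in unitmx] by split; exact: posdef_unitmx.
(* Woodbury: multiply by A^-1 + Omega and use A^-1 + Omega = A^-1 P Omega. *)
have HE : invmx (invmx A + Om) = A - A *m invmx P *m A.
  rewrite -[RHS](mulmxK uH) mulmxBl.
  have -> : A *m (invmx A + Om) = 1%:M + A *m Om by rewrite mulmxDr mulmxV.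
  have -> : A *m invmx P *m A *m (invmx A + Om) = A *m Om.
    rewrite -!mulmxA mulmxDr mulmxV//.
    have -> : 1%:M + A *m Om = P *m Om by rewrite /P mulmxDl mulVmx// addrC.
    by rewrite mulKmx.
  by rewrite addrK mul1mx.
have mE : qform P (invmx P *m A *m h) = qform (A *m invmx P *m A) h.
  rewrite qform_mulmx !trmx_mul trmx_inv (proj1 pP) (proj1 pA).
  by rewrite -!mulmxA mulKVmx.
have bE : bform P t (invmx P *m A *m h) = bform A t h.
  by rewrite /bform -!mulmxA mulKVmx.
have NE (S : 'M[R]_p) (u v : 'cV[R]_p) : S^T = S ->
    qform S (u - v) = qform S u - 2 * bform S u v + qform S v.
  move=> sS; rewrite -scaleN1r qformD// bformZr qformZ; ring.
rewrite (NE A)// ?(proj1 pA)// (NE P) ?(proj1 pP)// mE bE HE.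
rewrite !qformDl -[in X in _ = _ + X]scaleN1r qformZl.
ring.
Qed.

Lemma box_sqr_le (x a b : R) : a <= x <= b -> x ^+ 2 <= (`|a| + `|b|) ^+ 2.
Proof.
move=> /andP[xa xb]; rewrite -real_normK ?num_real//.
apply: lerXn2r; rewrite ?nnegrE ?addr_ge0// ler_norml; apply/andP; split.
  apply: le_trans xa; rewrite lerNl; apply: (le_trans (ler_norm _)).
  by rewrite normrN lerDl.
by apply: (le_trans xb); apply: (le_trans (ler_norm _)); rewrite lerDr.
Qed.

End QuadraticForms.

(** * Iterated integrals over column vectors *)

Section IteratedIntegral.
Context {R : realType}.
Local Notation mu := (@lebesgue_measure R).

(** Column vectors carry no sigma-algebra here.  Measurability on R^p is therefore
    tested along maps into R^p whose coordinates are measurable, which is equivalent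
    to Borel measurability and is stable under the slicing of coordinates done by
    the iterated integral. *)
Definition coord_measurable d (T : measurableType d) p (c : T -> 'cV[R]_p) :=
  forall i, measurable_fun setT (fun t => c t i ord0).

(** Measurability on T x R^p: the parameter t is what the induction on p feeds
    with the coordinates that have already been split off. *)
Definition jointly_measurable d (T : measurableType d) p
    (f : T -> 'cV[R]_p -> \bar R) : Prop :=
  forall d' (T' : measurableType d') (s : T' -> T) (c : T' -> 'cV[R]_p),
    measurable_fun setT s -> coord_measurable c ->
    measurable_fun setT (fun t => f (s t) (c t)).

Definition cVmeasurable p (f : 'cV[R]_p -> \bar R) : Prop :=
  forall d' (T' : measurableType d') (c : T' -> 'cV[R]_p),
    coord_measurable c -> measurable_fun setT (f \o c).

Lemma coord_measurable_col_mx d (T : measurableType d) p (x : T -> R)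
    (c : T -> 'cV[R]_p) :
  measurable_fun setT x -> coord_measurable c ->
  coord_measurable (fun t => col_mx (x t)%:M (c t) : 'cV[R]_p.+1).
Proof.
move=> mx mc i; have [j ->|j ->] := @split_ordP 1 p i.
  rewrite (_ : (fun _ => _) = x) //; apply/funext => t.
  by rewrite (@col_mxEu _ 1 p) ord1 mxE eqxx mulr1n.
rewrite (_ : (fun _ => _) = (fun t => c t j ord0)); first exact: mc.
by apply/funext => t; rewrite (@col_mxEd _ 1 p).
Qed.

Lemma jointly_measurable_slice d (T : measurableType d) p
    (f : T -> 'cV[R]_p -> \bar R) t : jointly_measurable f -> cVmeasurable (f t).
Proof.
by move=> mf d' T' c mc; apply: (mf _ _ (cst t)) => //; exact: measurable_cst.
Qed.

Lemma jointly_measurable_col_mx d (T : measurableType d) p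
    (f : T -> 'cV[R]_p.+1 -> \bar R) : jointly_measurable f ->
  jointly_measurable (fun (tx : T * R) (v : 'cV[R]_p) => f tx.1 (col_mx tx.2%:M v)).
Proof.
move=> mf d' T' s c ms mc; apply: (mf _ _ (fun t => (s t).1)).
  exact: (measurableT_comp measurable_fst).
apply: coord_measurable_col_mx => //.
exact: (measurableT_comp measurable_snd).
Qed.

Lemma cVmeasurable_col_mx p (f : 'cV[R]_p.+1 -> \bar R) : cVmeasurable f ->
  jointly_measurable (fun (x : R) (v : 'cV[R]_p) => f (col_mx x%:M v)).
Proof.
by move=> mf d' T' s c ms mc; apply: mf; exact: coord_measurable_col_mx.
Qed.

Lemma integral_cV_ge0 p (f : 'cV[R]_p -> \bar R) :
  (forall v, 0 <= f v)%E -> (0 <= integral_cV f)%E.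
Proof.
elim: p f => [|p IH] f f0 //=; apply: integral_ge0 => x _.
by apply: IH => v.
Qed.

(** The inner integrals are measurable in the remaining variables.  The parameter
    space T has to vary in the induction: one more coordinate turns it into T x R. *)
Lemma measurable_integral_cV d (T : measurableType d) p
    (f : T -> 'cV[R]_p -> \bar R) :
  jointly_measurable f -> (forall t v, 0 <= f t v)%E ->
  measurable_fun setT (fun t => integral_cV (f t)).
Proof.
elim: p d T f => [|p IH] d T f mf f0 /=.
  by apply: (mf _ _ id (cst 0)) => // i; exact: measurable_cst.
apply: (@measurable_fun_fubini_tonelli_F _ _ T (measurableTypeR R) R mu
  (fun tx : T * R => integral_cV (fun v => f tx.1 (col_mx tx.2%:M v)))).
- by apply: IH => //; exact: jointly_measurable_col_mx.
- by move=> tx; apply: integral_cV_ge0.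
Qed.

Lemma measurable_integral_cV_head p (f : 'cV[R]_p.+1 -> \bar R) :
  cVmeasurable f -> (forall v, 0 <= f v)%E ->
  measurable_fun setT
    (fun x : R => integral_cV (fun v : 'cV[R]_p => f (col_mx x%:M v))).
Proof.
move=> mf f0; apply: measurable_integral_cV; last by [].
exact: cVmeasurable_col_mx.
Qed.

(** A one-dimensional Tonelli exchange at each level of the iteration. *)
Lemma tonelli_cV d (T : measurableType d)
    (nu : {sigma_finite_measure set T -> \bar R}) p
    (f : T -> 'cV[R]_p -> \bar R) :
  jointly_measurable f -> (forall t v, 0 <= f t v)%E ->
  (\int[nu]_t integral_cV (f t) = integral_cV (fun v => \int[nu]_t f t v))%E.
Proof.
elim: p f => [|p IH] f mf f0 //=.
have := @fubini_tonelli _ _ T (measurableTypeR R) R nu mu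
  (fun tx : T * R => integral_cV (fun v => f tx.1 (col_mx tx.2%:M v))).
move=> -> /=.
- apply: eq_integral => x _; rewrite IH//.
  move=> d' T' s c ms mc; apply: mf => //.
  by apply: coord_measurable_col_mx.
- by apply: measurable_integral_cV => //; exact: jointly_measurable_col_mx.
- by move=> tx; apply: integral_cV_ge0.
Qed.

Lemma cVmeasurable_slice p (f : 'cV[R]_p.+1 -> \bar R) (x : R) :
  cVmeasurable f -> cVmeasurable (fun v : 'cV[R]_p => f (col_mx x%:M v)).
Proof. by move=> /cVmeasurable_col_mx /(jointly_measurable_slice x). Qed.

Lemma integral_cVZl p (f : 'cV[R]_p -> \bar R) (k : \bar R) :
  (0 <= k)%E -> cVmeasurable f -> (forall v, 0 <= f v)%E ->
  (integral_cV (fun v => k * f v) = k * integral_cV f)%E.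
Proof.
move=> k0; elim: p f => [|p IH] f mf f0 //=.
rewrite -ge0_integralZl//.
- apply: eq_integral => x _; apply: IH => //.
  exact: cVmeasurable_slice.
- exact: measurable_integral_cV_head.
- by move=> x _; exact: integral_cV_ge0.
Qed.

Lemma integral_cVD p (f g : 'cV[R]_p -> \bar R) :
  cVmeasurable f -> (forall v, 0 <= f v)%E ->
  cVmeasurable g -> (forall v, 0 <= g v)%E ->
  (integral_cV (fun v => f v + g v) = integral_cV f + integral_cV g)%E.
Proof.
elim: p f g => [|p IH] f g mf f0 mg g0 //=.
rewrite -ge0_integralD//.
- apply: eq_integral => x _; apply: IH => //; exact: cVmeasurable_slice.
- by move=> x _; exact: integral_cV_ge0.
- exact: measurable_integral_cV_head.
- by move=> x _; exact: integral_cV_ge0.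
- exact: measurable_integral_cV_head.
Qed.

Lemma le_integral_cV p (f g : 'cV[R]_p -> \bar R) :
  cVmeasurable f -> cVmeasurable g -> (forall v, 0 <= f v)%E ->
  (forall v, f v <= g v)%E ->
  (integral_cV f <= integral_cV g)%E.
Proof.
elim: p f g => [|p IH] f g mf mg f0 fg //=.
have g0 v : (0 <= g v)%E by exact: le_trans (fg v).
apply: ge0_le_integral => //.
- by move=> x _; exact: integral_cV_ge0.
- exact: measurable_integral_cV_head.
- exact: measurable_integral_cV_head.
- by move=> x _; apply: IH => //; exact: cVmeasurable_slice.
Qed.

Lemma measurable_affine (a c : R) :
  measurable_fun [set: R] (fun x : R => a + c * x).
Proof. by apply: measurable_funD => //; exact: mulrl_measurable. Qed.

(** Lebesgue measure is determined by its values on half-open intervals, and there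
    the scaling rule is explicit. *)
Lemma lebesgue_measure_affine (a c : R) (A : set R) : 0 < c -> measurable A ->
  (c%:E * mu ((fun x : R => a + c * x)%R @^-1` A) = mu A)%E.
Proof.
move=> c0 mA.
pose phi : measurableTypeR R -> measurableTypeR R := fun x => a + c * x.
have mphi : measurable_fun setT phi by exact: measurable_affine.
pose m : {measure set (measurableTypeR R) -> \bar R} :=
  mscale (NngNum (ltW c0)) (pushforward mu phi).
suff -> : mu A = m mphi A by [].
apply: lebesgue_measure_unique => // _ [[u v] _ <-] /=.
change (mu `]u, v] = (c%:E * mu (phi @^-1` `]u, v]))%E).
rewrite (_ : phi @^-1` _ = `](u - a) / c, (v - a) / c]%classic); last first.
  apply/seteqP; split => x /=; rewrite !in_itv /= ltr_pdivrMr// ler_pdivlMr//;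
  by rewrite ltrBlDl lerBrDl [x * c]mulrC.
rewrite !lebesgue_measure_itv /= !lte_fin ltr_pM2r ?invr_gt0// ltrD2r.
case: ifP => _; last by rewrite mule0.
by rewrite -!EFinB -EFinM; congr EFin; field; rewrite gt_eqF.
Qed.

Lemma integral_affine (a c : R) (f : R -> \bar R) : 0 < c ->
  measurable_fun setT f -> (forall x, 0 <= f x)%E ->
  (\int[mu]_x f x = c%:E * \int[mu]_x f (a + c * x)%R)%E.
Proof.
move=> c0 mf f0.
pose phi : measurableTypeR R -> measurableTypeR R := fun x => a + c * x.
have mphi : measurable_fun setT phi by exact: measurable_affine.
pose m : {measure set (measurableTypeR R) -> \bar R} :=
  mscale (NngNum (ltW c0)) (pushforward mu phi).
transitivity (\int[m mphi]_x f x)%E.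
  apply: eq_measure_integral => A mA _.
  exact/esym/lebesgue_measure_affine.
rewrite /m ge0_integral_mscale//; congr (_ * _)%E.
by rewrite ge0_integral_pushforward.
Qed.

Lemma cVmeasurable_affine p (a : 'cV[R]_p) c (f : 'cV[R]_p -> \bar R) :
  cVmeasurable f -> cVmeasurable (fun v => f (a + c *: v)).
Proof.
move=> mf d T s ms; apply: (mf _ _ (fun t => a + c *: s t)) => i.
rewrite (_ : (fun _ => _) = (fun t => a i ord0 + c * s t i ord0)).
  by apply: measurable_funD => //; apply: measurable_funM.
by apply/funext => t; rewrite !mxE.
Qed.

(** One-dimensional substitutions, one coordinate at a time.  It serves to centre
    the Gaussian integrals and to rescale theta. *)
Lemma integral_cV_affine p (a : 'cV[R]_p) (c : R) (f : 'cV[R]_p -> \bar R) :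
  0 < c -> cVmeasurable f -> (forall v, 0 <= f v)%E ->
  (integral_cV f = (c ^+ p)%:E * integral_cV (fun v => f (a + c *: v)%R))%E.
Proof.
move=> c0; elim: p a f => [|p IH] a f mf f0 /=.
  by rewrite expr0 mul1e; congr f; apply/matrixP => -[].
pose a1 : R := a ord0 ord0.
pose a2 : 'cV[R]_p := dsubmx (a : 'cV[R]_(1 + p)).
have aE x (v : 'cV[R]_p) : a + c *: col_mx x%:M v =
    col_mx (a1 + c * x)%:M (a2 + c *: v).
  apply/colP => i; have [j ->|j ->] := @split_ordP 1 p i.
    rewrite (@col_mxEu _ 1 p) 2!mxE (@col_mxEu _ 1 p) !ord1 !mxE eqxx !mulr1n.
    by congr (a _ _ + _); exact/val_inj.
  by rewrite (@col_mxEd _ 1 p) 2!mxE (@col_mxEd _ 1 p) !mxE.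
rewrite (@integral_affine a1 c)//; last 2 first.
- exact: measurable_integral_cV_head.
- by move=> x; exact: integral_cV_ge0.
rewrite exprS EFinM -muleA; congr (_ * _)%E.
rewrite -ge0_integralZl//; last 3 first.
- apply: (@measurable_integral_cV_head p (fun v => f (a + c *: v)%R)).
    exact: cVmeasurable_affine.
  by [].
- by move=> x _; exact: integral_cV_ge0.
- by rewrite lee_fin exprn_ge0 // ltW.
apply: eq_integral => x _.
rewrite (IH a2); last by [].
- by under [in RHS]eq_fun do rewrite aE.
- exact: cVmeasurable_slice.
Qed.

End IteratedIntegral.

(** * Measurable, integrable and non-negligible integrands *)

Section Integrands.
Context {R : realType}.
Local Notation mu := (@lebesgue_measure R).

Lemma measurable_qform d (T : measurableType d) p (S : 'M[R]_p)
    (c : T -> 'cV[R]_p) :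
  coord_measurable c -> measurable_fun setT (fun t => qform S (c t)).
Proof.
move=> mc; under eq_fun do rewrite qform_sum.
apply: measurable_sum => j; apply: measurable_sum => k.
by apply: measurable_funM; [apply: measurable_funM|exact: mc].
Qed.

Lemma coord_measurable_subl d (T : measurableType d) p (m : 'cV[R]_p)
    (c : T -> 'cV[R]_p) :
  coord_measurable c -> coord_measurable (fun t => c t - m).
Proof.
move=> mc i; rewrite (_ : (fun _ => _) = (fun t => c t i ord0 - m i ord0)).
  exact: measurable_funB.
by apply/funext => t; rewrite !mxE.
Qed.

(** Measurability of a set, tested in the same way as that of a function. *)
Definition cVmeasurable_set p (A : set 'cV[R]_p) : Prop :=
  forall d (T : measurableType d) (c : T -> 'cV[R]_p),
    coord_measurable c -> measurable (c @^-1` A).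

Lemma measurable_indic_cV d (T : measurableType d) p (A : set 'cV[R]_p)
    (c : T -> 'cV[R]_p) : cVmeasurable_set A ->
  coord_measurable c -> measurable_fun setT (fun t => \1_A (c t) : R).
Proof.
move=> mA mc; rewrite (_ : (fun t => _) = \1_(c @^-1` A)).
  by apply: measurable_indic; exact: mA.
by apply/funext => t; rewrite !indicE; congr (nat_of_bool _)%:R; rewrite !inE.
Qed.

Lemma cVmeasurable_setT p : cVmeasurable_set [set: 'cV[R]_p].
Proof. by move=> d T c mc; rewrite preimage_setT. Qed.

Lemma cVmeasurable_Theta0 p : cVmeasurable_set (@Theta0 R p).
Proof.
move=> d T c mc.
rewrite (_ : _ @^-1` _ =
    \bigcap_(i in [set: 'I_p]) ((fun t => c t i ord0) @^-1` `]-oo, 0%R])).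
  apply: fin_bigcap_measurable => // i _; rewrite -[X in measurable X]setTI.
  by apply: mc => //; exact: measurable_itv.
apply/seteqP; split => t /= h i; first by move=> _; rewrite /= in_itv /=.
by have := h i I; rewrite /= in_itv.
Qed.

Lemma Theta1E p : @Theta1 R p = ~` @Theta0 R p.
Proof.
apply/seteqP; split => x /=.
  by move=> [i xi] /(_ i); rewrite leNgt xi.
by move/existsNP => [i /negP]; rewrite -ltNge => ?; exists i.
Qed.

Lemma cVmeasurable_Theta1 p : cVmeasurable_set (@Theta1 R p).
Proof.
move=> d T c mc; rewrite Theta1E preimage_setC; apply: measurableC.
exact: cVmeasurable_Theta0.
Qed.

Lemma cVmeasurable_prod p (g : R -> R) : measurable_fun setT g ->
  cVmeasurable (fun v : 'cV[R]_p => (\prod_i g (v i ord0))%:E).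
Proof.
move=> mg d T c mc; apply/measurable_EFinP => /=.
by apply: measurable_prod => i _; apply: measurableT_comp => //; exact: mc.
Qed.

Lemma integral_cV_prod p (g : R -> R) (k : R) :
  measurable_fun setT g -> (forall x, 0 <= g x) ->
  (\int[mu]_x (g x)%:E = k%:E)%E ->
  (integral_cV (fun v : 'cV[R]_p => (\prod_i g (v i ord0))%:E) = (k ^+ p)%:E).
Proof.
move=> mg g0 gk.
have k0 : 0 <= k.
  by rewrite -lee_fin -gk; apply: integral_ge0 => x _; rewrite lee_fin.
have mprod q := @cVmeasurable_prod q g mg.
elim: p => [|p IH] /=; first by rewrite big_ord0 expr0.
have E (x : R) (v : 'cV[R]_p) :
    \prod_(i < p.+1) g (col_mx x%:M v i ord0) = g x * \prod_i g (v i ord0).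
  rewrite (@big_split_ord _ _ _ 1 p) /= big_ord1; congr (_ * _).
    by rewrite (@col_mxEu _ 1 p) mxE.
  by apply: eq_bigr => i _; rewrite (@col_mxEd _ 1 p).
under eq_integral => x _.
  under eq_fun do rewrite E EFinM.
  rewrite integral_cVZl ?lee_fin//; last first.
    by move=> v; rewrite lee_fin; exact: prodr_ge0.
  rewrite IH muleC.
  over.
rewrite /= ge0_integralZl//.
- by rewrite gk exprS EFinM muleC.
- exact/measurable_EFinP.
- by move=> x _; rewrite lee_fin.
- by rewrite lee_fin exprn_ge0.
Qed.

Lemma integral_oneDsqrV : (\int[mu]_x ((oneDsqr x)^-1)%:E = pi%:E)%E.
Proof.
rewrite (@ge0_symfun_integralT _ (fun x => (oneDsqr x)^-1)).
- rewrite -set_itvcy integral0y_oneDsqr -EFinM; congr EFin; by field.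
- by move=> x; rewrite invr_ge0 (le_trans ler01 (oneDsqr_ge1 x)).
- exact: continuous_oneDsqrV.
- by move=> x /=; rewrite /oneDsqr sqrrN.
Qed.

(** The product of the functions 1 / (1 + x_i^2) has integral pi^p; all the
    integrability claims are obtained from this one dominating function. *)
Lemma integral_cV_lty p (f : 'cV[R]_p -> R) (C : R) :
  0 <= C -> cVmeasurable (fun v => (f v)%:E) -> (forall v, 0 <= f v) ->
  (forall v, f v <= C * \prod_i (oneDsqr (v i ord0))^-1) ->
  (integral_cV (fun v => (f v)%:E) < +oo)%E.
Proof.
move=> C0 mf f0 fC.
have mg : measurable_fun setT (fun x : R => (oneDsqr x)^-1).
  apply: continuous_measurable_fun; exact: continuous_oneDsqrV.
have g0 (x : R) : 0 <= (oneDsqr x)^-1 by rewrite invr_ge0 (le_trans ler01 (oneDsqr_ge1 x)).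
apply: (@le_lt_trans _ _
  (integral_cV (fun v : 'cV[R]_p =>
     C%:E * (\prod_i (oneDsqr (v i ord0))^-1)%:E)))%E.
  apply: le_integral_cV => //.
  move=> d T c mc; apply: measurable_funeM; exact: (cVmeasurable_prod mg).
rewrite integral_cVZl//.
- by rewrite (integral_cV_prod _ mg g0 integral_oneDsqrV) -EFinM ltry.
- exact: (cVmeasurable_prod mg).
- by move=> v; rewrite lee_fin; exact: prodr_ge0.
Qed.

(** Strict positivity is read off from a box: the integral over it is at least
    C (b - a)^p. *)
Lemma integral_cV_gt0 p (f : 'cV[R]_p -> R) (a b C : R) :
  a < b -> 0 < C -> cVmeasurable (fun v => (f v)%:E) -> (forall v, 0 <= f v) ->
  (forall v : 'cV[R]_p, (forall i, a <= v i ord0 <= b) -> C <= f v) ->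
  (0 < integral_cV (fun v => (f v)%:E))%E.
Proof.
move=> ab C0 mf f0 fC.
have mg : measurable_fun setT (\1_(`[a, b]) : R -> R).
  by apply: measurable_indic; exact: measurable_itv.
have gk : (\int[mu]_x (\1_(`[a, b]) x)%:E = (b - a)%:E)%E.
  by rewrite integral_indic//= setIT lebesgue_measure_itv /= lte_fin ab.
apply: (@lt_le_trans _ _
  (integral_cV (fun v : 'cV[R]_p =>
     C%:E * (\prod_i (\1_(`[a, b]) (v i ord0) : R))%:E)))%E.
  rewrite integral_cVZl//; last 3 first.
  - exact: ltW.
  - exact: (cVmeasurable_prod mg).
  - by move=> v; rewrite lee_fin; exact: prodr_ge0.
  rewrite (integral_cV_prod _ mg _ gk)// -EFinM lte_fin mulr_gt0//.
  by rewrite exprn_gt0 // subr_gt0.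
apply: le_integral_cV => //.
- move=> d T c mc; apply: measurable_funeM; exact: (cVmeasurable_prod mg).
- move=> v; rewrite -EFinM lee_fin mulr_ge0 ?(ltW C0)//; exact: prodr_ge0.
move=> v; rewrite -EFinM lee_fin.
have [vb|/existsNP[i vi]] := pselect (forall i, a <= v i ord0 <= b).
  rewrite big1 ?mulr1; first exact: fC.
  by move=> i _; rewrite indicE mem_set /= ?in_itv /=.
by rewrite (bigD1 i)//= indicE memNset ?mul0r ?mulr0//=.
Qed.

End Integrands.

(** * The inverse gamma integral *)

Section InverseGamma.
Context {R : realType}.
Local Notation mu := (@lebesgue_measure R).

(** Lets the criteria stated for R^p serve on the line. *)
Lemma integral_cV1 (F : R -> \bar R) :
  (integral_cV (fun v : 'cV[R]_1 => F (v ord0 ord0)) = \int[mu]_x F x)%E.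
Proof.
apply: eq_integral => x _ /=; congr F.
by rewrite mxE; case: splitP => // j _; rewrite mxE ord1.
Qed.

Lemma integral_indicr (D : set R) (f : R -> R) :
  (\int[mu]_(x in D) (f x)%:E = \int[mu]_x (f x * \1_D x)%:E)%E.
Proof.
rewrite integral_mkcond; apply: eq_integral => x _.
by rewrite patchE indicE; case: ifP; rewrite ?mulr1 ?mulr0.
Qed.

(** From 1 + x <= M (1 + x / M) <= M exp (x / M) with M = 2 (N + 1), raised to the
    power N. *)
Lemma exprn_le_expR N :
  exists2 C : R, 0 < C & forall x, 0 <= x -> (1 + x) ^+ N <= C * expR (x / 2).
Proof.
pose M : R := 2 * N.+1%:R.
have M1 : 1 <= M by rewrite /M -natrM ler1n.
have M0 : 0 < M by rewrite (lt_le_trans ltr01).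
exists (M ^+ N) => [|x x0]; first by rewrite exprn_gt0.
apply: (@le_trans _ _ ((M * expR (x / M)) ^+ N)).
  apply: lerXn2r; rewrite ?nnegrE ?addr_ge0 ?mulr_ge0 ?expR_ge0 ?(ltW M0)//.
  apply: (@le_trans _ _ (M * (1 + x / M))).
    by rewrite mulrDr mulrCA mulfV ?gt_eqF// !mulr1 lerD2r.
  by rewrite ler_wpM2l ?(ltW M0)// expR_ge1Dx.
rewrite exprMn ler_wpM2l ?exprn_ge0 ?(ltW M0)// -expRM_natl ler_expR.
rewrite mulrCA ler_wpM2l// /M invfM mulrCA -[X in _ <= X]mulr1.
rewrite ler_wpM2l ?invr_ge0// ler_pdivrMr ?ltr0n// mul1r ler_nat.
exact: leqnSn.
Qed.

Definition ig_kernel (b K u : R) : R := u `^ (- b - 1) * expR (- (K / (2 * u))).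

(** On the half-line the inverse of u is a power of u, whose measurability is
    known. *)
Lemma ig_kernel_powR b K u : ig_kernel b K u * \1_(`]0, +oo[) u =
  u `^ (- b - 1) * expR (- (K / 2 * u `^ (-1))) * \1_(`]0, +oo[) u.
Proof.
rewrite indicE; case: (boolP (u \in _)) => [|_]; last by rewrite !mulr0.
rewrite inE /= in_itv /= andbT => u0.
by rewrite /ig_kernel powR_inv1 ?(ltW u0)// invfM mulrA.
Qed.

Lemma measurable_ig_kernel d (T : measurableType d) b (K u : T -> R) :
  measurable_fun setT K -> measurable_fun setT u ->
  measurable_fun setT (fun t => ig_kernel b (K t) (u t) * \1_(`]0, +oo[) (u t)).
Proof.
move=> mK mU; under eq_fun do rewrite ig_kernel_powR.
apply: measurable_funM.
  apply: measurable_funM; first exact: (measurableT_comp (measurable_powR _)).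
  apply: (measurableT_comp (@measurable_expR R)).
  apply: measurableT_comp => //; apply: measurable_funM.
    exact: measurable_funM.
  exact: (measurableT_comp (measurable_powR _)).
apply: measurableT_comp => //.
Qed.

Lemma ig_kernel_ge0 b K u : 0 <= ig_kernel b K u.
Proof. by rewrite mulr_ge0 ?powR_ge0 ?expR_ge0. Qed.

(** In terms of x = 1 / u the kernel is a power of x times exp (- x / 2), and the
    factor 1 + u^2 only lowers the exponent by 2; the hypothesis on b keeps the
    lowered exponent nonnegative. *)
Lemma ig_kernel1_le b : 1 <= b -> exists2 C : R, 0 < C & forall u : R, 0 < u ->
  ig_kernel b 1 u <= C * (oneDsqr u)^-1.
Proof.
move=> b1; have b0 : 0 <= b + 1 by lra.
have [N bN] : exists N : nat, b + 1 <= N%:R.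
  by exists (Num.truncn (b + 1)).+1; apply/ltW; rewrite truncnS_gt.
have [C C0 hC] := exprn_le_expR N.
exists (C + C) => [|u u0]; first by rewrite addr_gt0.
rewrite ler_pdivlMr; last by rewrite (lt_le_trans ltr01 (oneDsqr_ge1 u)).
pose x := u^-1.
have x0 : 0 < x by rewrite invr_gt0.
have uE r : u `^ r = x `^ (- r).
  by rewrite powRN /x -{1}[u]invrK -powR_inv1 ?(ltW x0)// -powRrM mulN1r powRN.
rewrite /ig_kernel mul1r invfM.
rewrite (_ : - (2^-1 * u^-1) = - (x / 2)); last by rewrite mulrC.
rewrite expRN mulrAC ler_pdivrMr ?expR_gt0// mulrDl /oneDsqr mulrDr mulr1.
have h r : 0 <= r -> r <= b + 1 -> x `^ r <= C * expR (x / 2).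
  move=> r0 rb; apply: le_trans (hC x (ltW x0)).
  apply: (@le_trans _ _ ((1 + x) `^ r)).
    apply: ge0_ler_powR => //; rewrite ?nnegrE ?addr_ge0 ?(ltW x0)//.
    by rewrite lerDr.
  rewrite -powR_mulrn ?addr_ge0 ?(ltW x0)//.
  by apply: ler_powR; rewrite ?lerDl ?(ltW x0)// (le_trans rb).
apply: lerD; first by rewrite uE opprB opprK addrC h.
rewrite -powR_mulrn ?(ltW u0)// -powRD; last by rewrite (gt_eqF u0) implybT.
rewrite uE; apply: h; lra.
Qed.

(** The substitution u = K x extracts K^(-b).  The remaining integral is a value of
    the Gamma function up to a factor; only its being positive and finite
    matters, since it cancels in ratios. *)
Lemma integral_ig_kernel b : 1 <= b -> exists2 g : R, 0 < g &
  forall K, 0 < K ->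
  (\int[mu]_(u in `]0%R, +oo[) (ig_kernel b K u)%:E = (K `^ (- b) * g)%:E)%E.
Proof.
move=> b1; pose F K u : R := ig_kernel b K u * \1_(`]0, +oo[) u.
have F0 K u : 0 <= F K u by rewrite mulr_ge0 ?ig_kernel_ge0.
have mF K : measurable_fun setT (F K) by exact: measurable_ig_kernel.
have mF1 : cVmeasurable (fun v : 'cV[R]_1 => (F 1 (v ord0 ord0))%:E).
  move=> d T c mc; apply/measurable_EFinP => /=; apply: measurableT_comp => //.
have [C C0 hC] := ig_kernel1_le b1.
have lty : (\int[mu]_u (F 1%R u)%:E < +oo)%E.
  rewrite -integral_cV1.
  apply: (@integral_cV_lty _ _ (fun v => F 1 (v ord0 ord0)) C) => // [|v].
    exact: ltW.
  rewrite big_ord1 /F indicE; case: (boolP (_ \in _)) => [|_].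
    by rewrite inE /= in_itv /= andbT mulr1 => /hC.
  by rewrite mulr0 mulr_ge0 ?(ltW C0)// invr_ge0 (le_trans ler01 (oneDsqr_ge1 _)).
have gt0 : (0 < \int[mu]_u (F 1%R u)%:E)%E.
  rewrite -integral_cV1.
  apply: (@integral_cV_gt0 _ _ (fun v => F 1 (v ord0 ord0)) 1 2
    (2 `^ (- b - 1) * expR (- 1))) => // [|v /(_ ord0)/andP[v1 v2]].
    by rewrite ltr1n.
  have v0 := lt_le_trans ltr01 v1.
  rewrite /F indicE mem_set /= ?in_itv /= ?v0// mulr1.
  apply: ler_pM; rewrite ?powR_ge0 ?expR_ge0//.
    rewrite -opprD !powRN lef_pV2 ?posrE ?powR_gt0//.
    by apply: ge0_ler_powR; rewrite ?nnegrE ?(ltW v0)//; lra.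
  rewrite ler_expR lerN2 ler_pdivrMr ?mulr_gt0// mul1r; lra.
have fin : (\int[mu]_u (F 1%R u)%:E)%E \is a fin_num by rewrite gt0_fin_numE.
exists (fine (\int[mu]_u (F 1%R u)%:E)%E) => [|K K0].
  by rewrite fine_gt0 // gt0.
rewrite integral_indicr (@integral_affine _ 0 K)//; last 2 first.
- by apply/measurable_EFinP; exact: (mF K).
- by move=> x; rewrite lee_fin F0.
under eq_integral => x _.
  rewrite add0r (_ : _ * _ = K `^ (- b - 1) * F 1 x); last first.
    rewrite /F !indicE.
    have -> : (K * x \in `]0, +oo[%classic) = (x \in `]0, +oo[%classic).
      by apply/idP/idP; rewrite !inE /= !in_itv /= !andbT pmulr_rgt0.
    case: (boolP (x \in _)) => [|_]; last by rewrite !mulr0.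
    rewrite inE /= in_itv /= andbT => x0; rewrite !mulr1 /ig_kernel.
    rewrite powRM ?(ltW x0) ?(ltW K0)// -mulrA; congr (_ * (_ * expR (- _))).
    by field; rewrite !gt_eqF.
  rewrite EFinM; over.
rewrite ge0_integralZl//=; last 3 first.
- by apply/measurable_EFinP; exact: (mF 1).
- by move=> x _; rewrite lee_fin F0.
- by rewrite lee_fin powR_ge0.
rewrite -[in LHS](fineK fin) -!EFinM mulrA; congr (_ * _)%:E.
rewrite -{1}[K]powRr1 ?(ltW K0)// -powRD; last by rewrite (gt_eqF K0) implybT.
by congr (_ `^ _); ring.
Qed.

End InverseGamma.

(** * Gaussian integrals over cones *)

Section Gaussian.
Context {R : realType}.

Definition cone p (A : set 'cV[R]_p) :=
  forall (c : R) x, 0 < c -> A (c *: x) <-> A x.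

Lemma cone_indic p (A : set 'cV[R]_p) c x : cone A -> 0 < c ->
  \1_A (c *: x) = \1_A x :> R.
Proof.
move=> cA c0; rewrite !indicE; congr (nat_of_bool _)%:R.
by apply/idP/idP; rewrite !inE => /cA; apply.
Qed.

Lemma cone_Theta0 p : cone (@Theta0 R p).
Proof.
by move=> c x c0; split => h i; have := h i; rewrite mxE pmulr_rle0.
Qed.

Lemma cone_Theta1 p : cone (@Theta1 R p).
Proof.
by move=> c x c0; split => -[i h]; exists i; move: h; rewrite mxE pmulr_rgt0.
Qed.

Lemma Theta0_box p (x : 'cV[R]_p) :
  (forall i, -1 <= x i ord0 <= 0) -> Theta0 x.
Proof. by move=> h i; have /andP[] := h i. Qed.

Lemma Theta1_box p (x : 'cV[R]_p) : (0 < p)%N ->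
  (forall i, 1 <= x i ord0 <= 2) -> Theta1 x.
Proof.
move=> p0 h; exists (Ordinal p0).
by have /andP[] := h (Ordinal p0) => /(lt_le_trans ltr01).
Qed.

Definition gauss_kernel p (G : 'M[R]_p) (m : 'cV[R]_p) (sig2 : R) (x : 'cV[R]_p) : R :=
  expR (- (qform G (x - m) / (2 * sig2))).

Lemma measurable_gauss_kernel d (T : measurableType d) p (G : 'M[R]_p) m sig2
    (c : T -> 'cV[R]_p) : coord_measurable c ->
  measurable_fun setT (fun t => gauss_kernel G m sig2 (c t)).
Proof.
move=> mc; apply: (measurableT_comp (@measurable_expR R)).
apply: measurableT_comp => //; apply: measurable_funM => //.
exact/measurable_qform/coord_measurable_subl.
Qed.

Lemma cVmeasurable_gauss p (G : 'M[R]_p) m sig2 A : cVmeasurable_set A ->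
  cVmeasurable (fun x => (gauss_kernel G m sig2 x * \1_A x)%:E).
Proof.
move=> mA d T c mc; apply/measurable_EFinP; apply: measurable_funM.
  exact: measurable_gauss_kernel.
exact: measurable_indic_cV.
Qed.

Lemma gauss_ge0 p (G : 'M[R]_p) m sig2 A x : 0 <= gauss_kernel G m sig2 x * \1_A x.
Proof. by rewrite mulr_ge0// expR_ge0. Qed.

(** The substitution x = m + sqrt sig2 u extracts the power of sig2, provided that
    it maps A onto itself.  This covers the two cases that occur: the whole space
    with any m, and a cone with m = 0. *)
Lemma gauss_integral p (G : 'M[R]_p) (A : set 'cV[R]_p) (a b : R) :
  posdef G -> cVmeasurable_set A -> a < b ->
  (forall x : 'cV[R]_p, (forall i, a <= x i ord0 <= b) -> A x) ->
  exists2 g : R, 0 < g & forall (m : 'cV[R]_p) (sig2 : R), 0 < sig2 ->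
    (forall x, \1_A (m + Num.sqrt sig2 *: x) = \1_A x :> R) ->
    (integral_cV (fun x => (gauss_kernel G m sig2 x * \1_A x)%:E) =
      (sig2 `^ (p%:R / 2) * g)%:E)%E.
Proof.
move=> pG mA ab hA.
pose F x := gauss_kernel G 0 1 x * \1_A x.
have [C C0 hC] := @exprn_le_expR R p.
have [c c0 hc] := prod_oneDsqr_le pG.
have lty : (integral_cV (fun x => (F x)%:E) < +oo)%E.
  apply: (@integral_cV_lty _ _ _ (c ^+ p * C)) => [||x|x].
  - by rewrite mulr_ge0 ?exprn_ge0 ?(ltW c0) ?(ltW C0).
  - exact: cVmeasurable_gauss.
  - exact: gauss_ge0.
  apply: (@le_trans _ _ (gauss_kernel G 0 1 x)).
    by rewrite -[X in _ <= X]mulr1 ler_wpM2l//; exact: expR_ge0.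
  rewrite prodfV ler_pdivlMr; last first.
    by apply: prodr_gt0 => i _; rewrite (lt_le_trans ltr01 (oneDsqr_ge1 _)).
  have q0 := posdef_ge0 x pG.
  rewrite /gauss_kernel subr0 mulr1 expRN mulrC ler_pdivrMr ?expR_gt0//.
  apply: (le_trans (hc x)); rewrite exprMn -mulrA ler_wpM2l ?hC//.
  by rewrite exprn_ge0// ltW.
have gt0 : (0 < integral_cV (fun x => (F x)%:E))%E.
  pose s := \sum_j \sum_k `|G k j|; pose B := (`|a| + `|b|) ^+ 2.
  apply: (@integral_cV_gt0 _ _ _ a b (expR (- (s * B / 2)))) => //.
  - exact: expR_gt0.
  - exact: cVmeasurable_gauss.
  - by move=> x; exact: gauss_ge0.
  move=> x xab; rewrite /F indicE mem_set ?mulr1; last exact: hA.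
  rewrite /gauss_kernel subr0 mulr1 ler_expR lerN2 ler_wpM2r//.
  by apply: qform_le_coord => i; exact: box_sqr_le.
have fin : (integral_cV (fun x => (F x)%:E))%E \is a fin_num.
  by rewrite gt0_fin_numE.
exists (fine (integral_cV (fun x => (F x)%:E))).
  by rewrite fine_gt0 // gt0.
move=> m sig2 s0 hm.
have r0 : 0 < Num.sqrt sig2 by rewrite sqrtr_gt0.
rewrite (@integral_cV_affine _ _ m (Num.sqrt sig2))//; last 2 first.
- exact: cVmeasurable_gauss.
- by move=> x; rewrite lee_fin gauss_ge0.
rewrite EFinM fineK//; congr (_ * _)%E; last first.
  congr integral_cV; apply/funext => x; rewrite /F hm; congr (_ * _)%:E.
  rewrite /gauss_kernel addrC addKr subr0 qformZ sqr_sqrtr ?(ltW s0)//.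
  by congr (expR (- _)); field; rewrite gt_eqF.
by rewrite -powR12_sqrt ?(ltW s0)// -powR_mulrn ?powR_ge0// -powRrM mulrC.
Qed.

End Gaussian.

(** * Student kernels as a function of their location *)

Section StudentLocation.
Context {R : realType}.

Lemma measurable_student_kernel d (T : measurableType d) p k (m : 'cV[R]_p) S
    (c : T -> 'cV[R]_p) : coord_measurable c ->
  measurable_fun setT (fun t => mvstudent_kernel k m S (c t)).
Proof.
move=> mc; apply: (measurableT_comp (measurable_powR _)).
apply: measurable_funD => //; apply: measurable_funM => //.
exact/measurable_qform/coord_measurable_subl.
Qed.

Definition student_mass p (k : R) (S : 'M[R]_p) (A : set 'cV[R]_p)
    (m : 'cV[R]_p) : R :=
  fine (integral_cV (fun x => (mvstudent_kernel k m S x * \1_A x)%:E)).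

(** If two numerators and two denominators are comparable up to the factor e, then
    so are the quotients up to e^2. *)
Lemma ratio_bounds (e X Y U V : R) : 0 < e -> 0 < U -> 0 < V -> 0 <= X ->
  0 <= Y -> X <= e * Y -> Y <= e * X -> U <= e * V -> V <= e * U ->
  e ^- 2 * (Y / V) <= X / U <= e ^+ 2 * (Y / V).
Proof.
move=> e0 U0 V0 X0 Y0 XY YX UV VU; apply/andP; split.
  rewrite (_ : e ^- 2 * (Y / V) = Y / (e ^+ 2 * V)); last first.
    by field; rewrite !gt_eqF.
  rewrite ler_pdivlMr// mulrAC ler_pdivrMr ?mulr_gt0 ?exprn_gt0//.
  rewrite (_ : X * _ = (e * X) * (e * V)); last by ring.
  by apply: ler_pM => //; exact: ltW.
rewrite mulrA ler_pdivlMr// mulrAC ler_pdivrMr//.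
rewrite (_ : _ * U = (e * Y) * (e * U)); last by ring.
by apply: ler_pM => //; exact: ltW.
Qed.

Lemma half_lower_bounds (x z s t : R) : 0 < x -> 0 < z -> x <= s -> z <= t ->
  s + t = 1 -> x / 2 <= s <= 1 - z / 2.
Proof. by move=> *; apply/andP; split; lra. Qed.

Lemma student_mass_ge0 p (k : R) (S : 'M[R]_p) (A : set 'cV[R]_p) m :
  0 <= student_mass k S A m.
Proof.
apply: fine_ge0; apply: integral_cV_ge0 => x.
by rewrite lee_fin mulr_ge0// powR_ge0.
Qed.

Section Fixed.
Context (p : nat) (k : R) (S : 'M[R]_p).
Hypothesis k0 : 0 < k.
Hypothesis pk : p%:R <= k.
Hypothesis pS : posdef (invmx S).
Local Notation K := (mvstudent_kernel k).
Implicit Types (A : set 'cV[R]_p) (m : 'cV[R]_p).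

Lemma cVmeasurable_student A m : cVmeasurable_set A ->
  cVmeasurable (fun x => (K m S x * \1_A x)%:E).
Proof.
move=> mA d T c mc; apply/measurable_EFinP; apply: measurable_funM.
  exact: measurable_student_kernel.
exact: measurable_indic_cV.
Qed.

Lemma student_ge0 A m x : 0 <= K m S x * \1_A x.
Proof. by rewrite mulr_ge0// powR_ge0. Qed.

(** The price, in the density, of moving the location of a Student kernel by b. *)
Definition shift_factor (b : 'cV[R]_p) : R :=
  ((1 + Num.sqrt (qform (invmx S) b / k)) ^+ 2) `^ ((k + p%:R) / 2).

Lemma shift_factorN b : shift_factor (- b) = shift_factor b.
Proof. by rewrite /shift_factor -scaleN1r qformZ sqrrN expr1n mul1r. Qed.

Lemma student_kernel_shift_le m m' x :
  K m S x <= shift_factor (m - m') * K m' S x.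
Proof.
rewrite /mvstudent_kernel !powRN /shift_factor.
have q1 (y : 'cV[R]_p) : 0 < 1 + qform (invmx S) y / k.
  by rewrite ltr_wpDr// divr_ge0 ?(ltW k0)// posdef_ge0.
rewrite ler_pdivlMr ?powR_gt0// mulrC ler_pdivrMr ?powR_gt0//.
rewrite -powRM ?sqr_ge0 ?(ltW (q1 _))//.
apply: ge0_ler_powR; rewrite ?nnegrE ?mulr_ge0 ?sqr_ge0 ?(ltW (q1 _))//.
  by rewrite addr_ge0// ltW.
rewrite (_ : x - m' = (x - m) + (m - m')); last by rewrite addrA subrK.
exact: student_shift_le.
Qed.

(** The exponent (k + p) / 2 is at least p because p <= k, so the kernel is below
    the p-th power of 1 / (1 + q / k), which is dominated by a product of
    one-dimensional functions. *)
Lemma student_kernel0_le : exists2 C : R, 0 < C &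
  forall x, K 0 S x <= C * \prod_i (oneDsqr (x i ord0))^-1.
Proof.
have ik0 : 0 < k^-1 by rewrite invr_gt0.
have [c c0 hc] := prod_oneDsqr_le (posdefZ ik0 pS).
exists (c ^+ p) => [|x]; first by rewrite exprn_gt0.
rewrite prodfV ler_pdivlMr; last first.
  by apply: prodr_gt0 => i _; rewrite (lt_le_trans ltr01 (oneDsqr_ge1 _)).
have := hc x; rewrite qformZl exprMn.
rewrite /mvstudent_kernel subr0 powRN.
set u := qform _ x; have u0 : 0 <= u by exact: posdef_ge0.
have q1 : 1 <= 1 + u / k by rewrite lerDl divr_ge0// ltW.
have q0 := lt_le_trans ltr01 q1.
rewrite [k^-1 * u]mulrC => h.
rewrite mulrC ler_pdivrMr ?powR_gt0//; apply: (le_trans h).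
rewrite ler_wpM2l ?exprn_ge0 ?(ltW c0)// -powR_mulrn ?(ltW q0)//.
by apply: ler_powR => //; rewrite ler_pdivlMr// mulr_natr mulr2n lerD2r.
Qed.

Lemma student_lty A m : cVmeasurable_set A ->
  (integral_cV (fun x => (K m S x * \1_A x)%:E) < +oo)%E.
Proof.
move=> mA; have [C C0 hC] := student_kernel0_le.
have s0 : 0 <= shift_factor (m - 0) by exact: powR_ge0.
apply: (@integral_cV_lty _ _ _ (shift_factor (m - 0) * C)) => [||x|x].
- by rewrite mulr_ge0// ltW.
- exact: cVmeasurable_student.
- exact: student_ge0.
rewrite -mulrA; apply: (@le_trans _ _ (K m S x)).
  rewrite -[X in _ <= X]mulr1 ler_wpM2l//; exact: powR_ge0.
apply: (le_trans (student_kernel_shift_le m 0 x)).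
by rewrite ler_wpM2l.
Qed.

Lemma student_massE A m : cVmeasurable_set A ->
  (integral_cV (fun x => (K m S x * \1_A x)%:E) =
   (student_mass k S A m)%:E)%E.
Proof.
move=> mA; rewrite /student_mass fineK// ge0_fin_numE ?student_lty//.
by apply: integral_cV_ge0 => x; rewrite lee_fin student_ge0.
Qed.

(** The pointwise comparison of kernels, integrated over A.  The masses are not
    normalised, so the same bound serves for numerators and for the normalising
    integral (A the whole space). *)
Lemma student_mass_shift_le A m m' : cVmeasurable_set A ->
  student_mass k S A m <= shift_factor (m - m') * student_mass k S A m'.
Proof.
move=> mA.
suff : (integral_cV (fun x => (K m S x * \1_A x)%:E) <=
    (shift_factor (m - m'))%:E *
    integral_cV (fun x => (K m' S x * \1_A x)%:E))%E.
  by rewrite (student_massE m mA) (student_massE m' mA) -EFinM lee_fin.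
rewrite -integral_cVZl; last 3 first.
- by rewrite lee_fin; exact: powR_ge0.
- exact: cVmeasurable_student.
- by move=> x; rewrite lee_fin student_ge0.
apply: le_integral_cV.
- exact: cVmeasurable_student.
- move=> d T c mc; apply: measurable_funeM.
  exact: (@cVmeasurable_student A m').
- by move=> x; rewrite lee_fin student_ge0.
move=> x; rewrite -EFinM lee_fin mulrA ler_wpM2r//.
exact: student_kernel_shift_le.
Qed.

(** On a bounded box the quadratic form is bounded, hence the kernel is bounded
    below by a positive constant. *)
Lemma student_mass_gt0 A m (a b : R) : a < b -> cVmeasurable_set A ->
  (forall x : 'cV[R]_p, (forall i, a <= x i ord0 <= b) -> A x) ->
  0 < student_mass k S A m.
Proof.
move=> ab mA hA; rewrite -lte_fin -student_massE//.
suff [B B0 hB] : exists2 B : R, 0 < B & forall x : 'cV[R]_p,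
    (forall i, a <= x i ord0 <= b) -> B <= K m S x.
  apply: (@integral_cV_gt0 _ _ _ a b B) => //.
  - exact: cVmeasurable_student.
  - by move=> x; exact: student_ge0.
  - by move=> x xab; rewrite indicE mem_set ?mulr1; [exact: hB|exact: hA].
pose M := (`|a| + `|b| + \sum_i `|m i ord0|) ^+ 2.
pose s := \sum_j \sum_k `|invmx S k j|.
have s0 : 0 <= s by apply: sumr_ge0 => j _; apply: sumr_ge0.
have M0 : 0 <= M by exact: sqr_ge0.
have u0 : 0 < 1 + s * M / k.
  by rewrite ltr_wpDr// divr_ge0 ?(ltW k0)// mulr_ge0.
exists ((1 + s * M / k) `^ (- ((k + p%:R) / 2))) => [|x xab].
  exact: powR_gt0.
have q0 := posdef_ge0 (x - m) pS.
rewrite /mvstudent_kernel !powRN lef_pV2 ?posrE ?powR_gt0//; last first.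
  by rewrite ltr_wpDr// divr_ge0// ltW.
apply: ge0_ler_powR; rewrite ?nnegrE ?(ltW u0)//.
- by rewrite divr_ge0// addr_ge0// ltW.
- by rewrite addr_ge0// divr_ge0// ltW.
rewrite lerD2l ler_wpM2r ?invr_ge0 ?(ltW k0)//.
apply: qform_le_coord => i; rewrite !mxE /M -real_normK ?num_real//.
apply: lerXn2r; rewrite ?nnegrE ?addr_ge0 ?sumr_ge0//.
apply: (le_trans (ler_normB _ _)); apply: lerD; last first.
  by rewrite (bigD1 i)//= lerDl sumr_ge0.
have /andP[xa xb] := xab i; rewrite ler_norml; apply/andP; split.
  apply: le_trans xa; rewrite lerNl; apply: (le_trans (ler_norm _)).
  by rewrite normrN lerDl.
apply: (le_trans xb); apply: (le_trans (ler_norm _)); by rewrite lerDr.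
Qed.

Lemma student_mass_setT m :
  student_mass k S (@Theta0 R p) m + student_mass k S (@Theta1 R p) m =
  student_mass k S setT m.
Proof.
have m0 := @cVmeasurable_Theta0 R p; have m1 := @cVmeasurable_Theta1 R p.
apply: EFin_inj; rewrite EFinD -!student_massE//; last exact: cVmeasurable_setT.
rewrite -integral_cVD.
- congr integral_cV; apply/funext => x; rewrite -EFinD -mulrDr Theta1E.
  by rewrite indicC /= !indicE in_setT; case: (x \in _); rewrite ?addr0 ?add0r.
- exact: cVmeasurable_student.
- by move=> x; rewrite lee_fin student_ge0.
- exact: cVmeasurable_student.
- by move=> x; rewrite lee_fin student_ge0.
Qed.

Lemma mvstudent_probE A m :
  mvstudent_prob k m S A = student_mass k S A m / student_mass k S setT m.
Proof.
rewrite /mvstudent_prob /student_mass; congr (_ / fine (integral_cV _)).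
by apply/funext => x; rewrite indicT mulr1.
Qed.

End Fixed.

End StudentLocation.

Section StudentContinuity.
Context {R : realType}.

(** Squeezed between 1 and a power with an integer exponent, for which continuity
    at 0 is elementary. *)
Lemma cvg_shift_factor (T : Type) (F : set_system T) (FF : Filter F)
    p (k : R) (S : 'M[R]_p) (b : T -> 'cV[R]_p) : 0 < k ->
  qform (invmx S) (b x) @[x --> F] --> 0 ->
  shift_factor k S (b x) @[x --> F] --> (1 : R).
Proof.
move=> k0 b0.
have [N hN] : exists N : nat, (k + p%:R) / 2 <= N%:R.
  by exists (Num.truncn ((k + p%:R) / 2)).+1; apply/ltW; rewrite truncnS_gt.
pose h (x : R) : R := (1 + Num.sqrt (x / k)) ^+ (2 * N).
apply: (@squeeze_cvgr _ _ _ _ (cst 1) (fun x => h (qform (invmx S) (b x)))).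
- apply: nearW => x /=.
  have X1 : 1 <= 1 + Num.sqrt (qform (invmx S) (b x) / k).
    by rewrite lerDl sqrtr_ge0.
  have X2 := exprn_ege1 2 X1; rewrite /shift_factor /h; apply/andP; split.
    rewrite -[X in X <= _](powRr0 ((1 + Num.sqrt (qform (invmx S) (b x) / k)) ^+ 2)).
    by apply: ler_powR => //; rewrite divr_ge0// addr_ge0// ltW.
  rewrite exprM -[X in _ <= X]powR_mulrn ?(le_trans ler01)//.
  exact: ler_powR.
- exact: cvg_cst.
- have a1 : qform (invmx S) (b x) / k @[x --> F] --> (0 : R).
    by rewrite -[X in _ --> X](mul0r k^-1); apply: cvgM b0 _; exact: cvg_cst.
  have a2 : Num.sqrt (qform (invmx S) (b x) / k) @[x --> F] --> (0 : R).
    rewrite -[X in _ --> X](sqrtr0 R).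
    exact: (continuous_cvg FF (@sqrt_continuous R 0) a1).
  have a3 : 1 + Num.sqrt (qform (invmx S) (b x) / k) @[x --> F] --> (1 : R).
    by rewrite -[X in _ --> X]addr0; apply: cvgD a2; exact: cvg_cst.
  rewrite -[X in _ --> X](expr1n _ (2 * N)).
  exact: (continuous_cvg FF (@exprn_continuous R (2 * N) 1) a3).
Qed.

(** Continuity of Student probabilities in the location follows from the comparison
    of masses: the quotient moves by at most the square of a factor tending
    to 1. *)
Lemma cvg_mvstudent_prob (T : Type) (F : set_system T) (FF : Filter F)
    p (k : R) (S : 'M[R]_p) A (f : T -> 'cV[R]_p) m :
  0 < k -> p%:R <= k -> posdef (invmx S) -> cVmeasurable_set A ->
  0 < student_mass k S setT m -> (forall x, 0 < student_mass k S setT (f x)) ->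
  qform (invmx S) (f x - m) @[x --> F] --> 0 ->
  mvstudent_prob k (f x) S A @[x --> F] --> mvstudent_prob k m S A.
Proof.
move=> k0 pk pS mA mT fT fm.
have mTT := @cVmeasurable_setT R p.
have e1 := cvg_shift_factor FF k0 fm.
pose e x := shift_factor k S (f x - m).
have e0 x : 0 < e x.
  rewrite powR_gt0// exprn_gt0// ltr_wpDr// sqrtr_ge0.
set u := mvstudent_prob k m S A.
have eE x : e x ^- 2 * u <= mvstudent_prob k (f x) S A <= e x ^+ 2 * u.
  rewrite /u !mvstudent_probE.
  have h1 := student_mass_shift_le k0 pk pS (f x) m mA.
  have h2 := student_mass_shift_le k0 pk pS m (f x) mA.
  have h3 := student_mass_shift_le k0 pk pS (f x) m mTT.
  have h4 := student_mass_shift_le k0 pk pS m (f x) mTT.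
  rewrite -opprB shift_factorN in h2; rewrite -opprB shift_factorN in h4.
  rewrite -/(e x) in h1 h2 h3 h4.
  have ex := e0 x; have fx := fT x.
  by apply: ratio_bounds => //; exact: student_mass_ge0.
apply: (@squeeze_cvgr _ _ _ _ (fun x => e x ^- 2 * u) (fun x => e x ^+ 2 * u)).
- exact: nearW.
- rewrite -[X in _ --> X]mul1r; apply: cvgM; last exact: cvg_cst.
  rewrite -[X in _ --> X]invr1; apply: cvgV; first exact: oner_neq0.
  rewrite -[X in _ --> X](expr1n _ 2).
  exact: (continuous_cvg FF (@exprn_continuous R 2 1) e1).
- rewrite -[X in _ --> X]mul1r; apply: cvgM; last exact: cvg_cst.
  rewrite -[X in _ --> X](expr1n _ 2).
  exact: (continuous_cvg FF (@exprn_continuous R 2 1) e1).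
Qed.

End StudentContinuity.

(** * Integrating out the nuisance parameters and the variance *)

Section Mixture.
Context {R : realType}.
Local Notation mu := (@lebesgue_measure R).

(** The rescaling of theta that turns the posterior kernel into the standard Student
    kernel: D + q (r x - m) = D (1 + q (x - m / r) / k) for r^2 = D / k. *)
Lemma student_scaling p (P : 'M[R]_p) (A : set 'cV[R]_p) (m : 'cV[R]_p)
    (k D b : R) :
  posdef P -> 0 < k -> 0 < D -> cone A -> cVmeasurable_set A ->
  b = (k + p%:R) / 2 ->
  (integral_cV (fun x => ((D + qform P (x - m)) `^ (- b) * \1_A x)%:E) =
   (Num.sqrt (D / k) ^+ p * D `^ (- b))%:E *
   integral_cV (fun x =>
     (mvstudent_kernel k ((Num.sqrt (D / k))^-1 *: m) (invmx P) x * \1_A x)%:E))%E.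
Proof.
move=> pP k0 D0 cA mA bE.
set r := Num.sqrt (D / k).
have r0 : 0 < r by rewrite sqrtr_gt0 divr_gt0.
have r2 : r ^+ 2 = D / k by rewrite sqr_sqrtr// divr_ge0// ltW.
have mF : cVmeasurable
    (fun x => ((D + qform P (x - m)) `^ (- b) * \1_A x)%:E).
  move=> d T c mc; apply/measurable_EFinP; apply: measurable_funM.
    apply: (measurableT_comp (measurable_powR _)).
    apply: measurable_funD => //.
    exact/measurable_qform/coord_measurable_subl.
  exact: measurable_indic_cV.
rewrite (@integral_cV_affine _ _ 0 r)//; last first.
  by move=> x; rewrite lee_fin mulr_ge0// powR_ge0.
rewrite EFinM -muleA; congr (_ * _)%E.
rewrite -integral_cVZl.
- congr integral_cV; apply/funext => x.
  rewrite -EFinM mulrA add0r cone_indic//; congr (_ * _)%:E.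
  rewrite /mvstudent_kernel invmxK -bE -powRM ?(ltW D0)//; last first.
    by rewrite addr_ge0// divr_ge0 ?posdef_ge0 ?(ltW k0).
  congr (_ `^ _); rewrite mulrDr mulr1; congr (_ + _).
  rewrite (_ : r *: x - m = r *: (x - r^-1 *: m)); last first.
    by rewrite scalerBr scalerA mulfV ?gt_eqF// scale1r.
  by rewrite qformZ r2 mulrA mulrAC.
- by rewrite lee_fin powR_ge0.
- by apply: cVmeasurable_student => //; rewrite invmxK.
- by move=> x; rewrite lee_fin mulr_ge0// powR_ge0.
Qed.

(** The order of integration is: gamma first, which costs sig2^(q / 2); then, after
    a Tonelli exchange, sig2, which turns the exponential of - K(theta) / (2 sig2)
    into K(theta)^(-b); then the rescaling of theta.  The constant C does not depend
    on A, on the locations or on the weight w, so it cancels in the posterior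
    probability and in the Bayes factor. *)
Lemma mixture_integral p q (P : 'M[R]_p) (G : 'M[R]_q) (k b D : R) :
  posdef P -> posdef G -> 0 < k -> 1 <= b -> p%:R <= k ->
  b = (k + p%:R) / 2 -> 0 < D ->
  exists2 C : R, 0 < C &
  forall (w : R) (A : set 'cV[R]_p) (m : 'cV[R]_p) (g : 'cV[R]_q)
    (f : 'cV[R]_p -> 'cV[R]_q -> R -> R),
    0 <= w -> cone A -> cVmeasurable_set A ->
    (forall theta gamma sig2, 0 < sig2 ->
      f theta gamma sig2 = w * sig2 `^ (- (b + q%:R / 2) - 1) *
        expR (- ((D + qform P (theta - m)) / (2 * sig2))) *
        gauss_kernel G g sig2 gamma * \1_A theta) ->
    integral_params f =
      w * C * student_mass k (invmx P) A ((Num.sqrt (D / k))^-1 *: m).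
Proof.
move=> pP pG k0 b1 pk bE D0.
have [gG gG0 hG] := @gauss_integral _ q G setT 0 1 pG
  (@cVmeasurable_setT _ _) ltr01 (fun _ _ => I).
have [c c0 hc] := integral_ig_kernel b1.
set r := Num.sqrt (D / k).
have r0 : 0 < r by rewrite sqrtr_gt0 divr_gt0.
exists (gG * c * (r ^+ p * D `^ (- b))).
  by rewrite !mulr_gt0 ?exprn_gt0 ?powR_gt0.
move=> w A m g f w0 cA mA fE.
pose K theta := D + qform P (theta - m).
have K0 theta : 0 < K theta by rewrite ltr_wpDr// posdef_ge0.
have mK d (T : measurableType d) (v : T -> 'cV[R]_p) : coord_measurable v ->
    measurable_fun setT (fun t => K (v t)).
  move=> mv; apply: measurable_funD => //.
  exact/measurable_qform/coord_measurable_subl.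
(* For fixed sig2 the inner theta integral factors out of the gamma integral. *)
have inner sig2 : 0 < sig2 ->
    integral_cV (fun gamma => integral_cV (fun theta => (f theta gamma sig2)%:E)) =
    integral_cV (fun theta => (w * gG * (ig_kernel b (K theta) sig2 * \1_A theta))%:E).
  move=> s0.
  pose E theta : R := expR (- (K theta / (2 * sig2))) * \1_A theta.
  have E0 theta : 0 <= E theta by rewrite mulr_ge0// expR_ge0.
  have mE : cVmeasurable (fun theta => (E theta)%:E).
    move=> d T v mv; apply/measurable_EFinP; apply: measurable_funM.
      apply: (measurableT_comp (@measurable_expR R)).
      apply: measurableT_comp => //; apply: measurable_funM => //.
      exact: mK.
    exact: measurable_indic_cV.
  set I := integral_cV (fun theta => (E theta)%:E).
  have I0 : (0 <= I)%E by apply: integral_cV_ge0 => x; rewrite lee_fin.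
  set s := sig2 `^ (- (b + q%:R / 2) - 1).
  have s0' : 0 <= s by exact: powR_ge0.
  transitivity (integral_cV (fun gamma : 'cV[R]_q =>
      ((w * s)%:E * I) * (gauss_kernel G g sig2 gamma * \1_setT gamma)%:E))%E.
    congr integral_cV; apply/funext => gamma.
    rewrite indicT mulr1 muleAC -EFinM -integral_cVZl//; last first.
      by rewrite lee_fin !mulr_ge0// expR_ge0.
    congr integral_cV; apply/funext => theta.
    rewrite fE// -EFinM; congr EFin; rewrite /E /K -/s; ring.
  rewrite integral_cVZl//; last 3 first.
  - by rewrite mule_ge0// lee_fin mulr_ge0.
  - by apply: cVmeasurable_gauss; exact: cVmeasurable_setT.
  - by move=> x; rewrite lee_fin gauss_ge0.
  rewrite hG//.
  rewrite muleAC -EFinM -integral_cVZl//; last first.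
    by rewrite lee_fin !mulr_ge0// ?powR_ge0// ltW.
  congr integral_cV; apply/funext => theta; rewrite -EFinM; congr EFin.
  rewrite /E /ig_kernel.
  have -> : sig2 `^ (- b - 1) = s * sig2 `^ (q%:R / 2).
    rewrite /s -powRD; last by rewrite (gt_eqF s0) implybT.
    by congr (_ `^ _); ring.
  ring.
rewrite /integral_params.
transitivity (fine (\int[mu]_sig2 integral_cV (fun theta =>
   (w * gG * \1_A theta * (ig_kernel b (K theta) sig2 * \1_(`]0, +oo[) sig2))%:E)))%E.
  congr fine; rewrite integral_mkcond; apply: eq_integral => sig2 _.
  rewrite patchE; case: ifPn => [|ns].
    rewrite inE /= in_itv /= andbT => s0; rewrite inner//.
    congr integral_cV; apply/funext => theta; congr EFin.
    have -> : \1_(`]0, +oo[) sig2 = 1 :> R.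
      by rewrite indicE mem_set//= in_itv /= s0.
    ring.
  rewrite [X in _ = integral_cV X](_ : _ = fun theta =>
    (0 * (gauss_kernel P m 1 theta * \1_A theta)%:E)%E).
    rewrite integral_cVZl ?mul0e//; first exact: cVmeasurable_gauss.
    by move=> x; rewrite lee_fin gauss_ge0.
  apply/funext => theta; rewrite [\1_(`]0, +oo[) sig2]indicE (negbTE ns).
  by rewrite !mulr0 mul0e.
(* The indicator of the half-line has been moved into the integrand, so that the
   exchange is between Lebesgue integrals over the whole line and over R^p. *)
rewrite (@tonelli_cV _ _ _ mu); last 2 first.
- move=> d T s v ms mv; apply/measurable_EFinP; apply: measurable_funM.
    apply: measurable_funM => //; exact: measurable_indic_cV.
  apply: measurable_ig_kernel; [exact: mK|exact: ms].
- move=> s x; rewrite lee_fin; apply: mulr_ge0; apply: mulr_ge0 => //.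
    by rewrite mulr_ge0// ltW.
  exact: ig_kernel_ge0.
transitivity (fine (integral_cV (fun theta =>
   (w * gG * c)%:E * ((D + qform P (theta - m)) `^ (- b) * \1_A theta)%:E)))%E.
  congr fine; congr integral_cV; apply/funext => theta.
  under eq_integral do rewrite EFinM.
  rewrite ge0_integralZl//; last 3 first.
  - apply/measurable_EFinP.
    apply: measurable_ig_kernel => //.
  - by move=> x _; rewrite lee_fin mulr_ge0// ig_kernel_ge0.
  - by rewrite lee_fin !mulr_ge0// ltW.
  rewrite -integral_indicr hc// -!EFinM; congr EFin; rewrite /K; ring.
rewrite integral_cVZl; last 3 first.
- by rewrite lee_fin !mulr_ge0// ltW.
- move=> d T v mv; apply/measurable_EFinP; apply: measurable_funM.
    apply: (measurableT_comp (measurable_powR _)); exact: mK.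
  exact: measurable_indic_cV.
- by move=> x; rewrite lee_fin mulr_ge0// powR_ge0.
rewrite (@student_scaling _ _ _ _ k)// -/r.
rewrite student_massE// ?invmxK// -!EFinM /=; ring.
Qed.

End Mixture.

(** * Normal densities and limits used for the model *)

Section NormalDensity.
Context {R : realType}.

Lemma mvnormal_pdf_scale p (S : 'M[R]_p) (m x : 'cV[R]_p) (sig2 : R) :
  posdef S -> 0 < sig2 ->
  mvnormal_pdf m (sig2 *: S) x =
  (Num.sqrt ((2 * pi) ^+ p * \det S))^-1 * sig2 `^ (- (p%:R / 2)) *
  gauss_kernel (invmx S) m sig2 x.
Proof.
move=> pS s0; rewrite /mvnormal_pdf /gauss_kernel.
have -> : invmx (sig2 *: S) = sig2^-1 *: invmx S.
  by rewrite invmxZ ?unitmxZ ?unitfE ?gt_eqF// posdef_unitmx.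
rewrite qformZl detZ mulrCA sqrtrM ?exprn_ge0 ?(ltW s0)// invfM.
have -> : (Num.sqrt (sig2 ^+ p))^-1 = sig2 `^ (- (p%:R / 2)).
  rewrite powRN -powR12_sqrt ?exprn_ge0 ?(ltW s0)//.
  by rewrite -powR_mulrn ?(ltW s0)// -powRrM.
rewrite mulrC [_^-1 * _]mulrC; congr (_ * expR (- _)).
by rewrite invfM mulrC mulrA mulrC mulrA mulrAC mulrC mulrA.
Qed.

Lemma gls_normal_eq n r (S : 'M[R]_n) (X : 'M[R]_(n, r)) y :
  X^T *m invmx S *m X \in unitmx ->
  X^T *m invmx S *m X *m gls S X y = X^T *m invmx S *m y.
Proof. by move=> u; rewrite /gls mulKVmx. Qed.

(** Dividing numerator and denominator by c leaves d / c^2 + w under the root. *)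
Lemma cvg_scaled_ratio (d w k : R) : 0 < w -> 0 < k ->
  (Num.sqrt ((d + c ^+ 2 * w) / k))^-1 * c @[c --> +oo] -->
    (Num.sqrt (w / k))^-1.
Proof.
move=> w0 k0.
have iv : (c^-1 : R) @[c --> +oo] --> (0 : R).
  by apply/gtr0_cvgV0; [exact: nbhs_pinfty_gt|exact: cvg_id].
have h : (Num.sqrt ((d * c^-1 ^+ 2 + w) / k))^-1 @[c --> +oo] -->
    (Num.sqrt (w / k))^-1.
  apply: cvgV; first by rewrite gt_eqF// sqrtr_gt0 divr_gt0.
  apply: (continuous_cvg _ (@sqrt_continuous R _)).
  apply: cvgM; last exact: cvg_cst.
  rewrite -[X in _ --> X]add0r; apply: cvgD; last exact: cvg_cst.
  rewrite -[X in _ --> X](mulr0 d); apply: cvgM; first exact: cvg_cst.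
  rewrite -[X in _ --> X](expr0n _ 2).
  exact: (continuous_cvg _ (@exprn_continuous R 2 0) iv).
apply: cvg_trans h; apply: near_eq_cvg; near=> c.
have c0 : 0 < c by near: c; exact: nbhs_pinfty_gt.
rewrite (_ : (d + c ^+ 2 * w) / k = c ^+ 2 * ((d * c^-1 ^+ 2 + w) / k));
  last by field; rewrite !gt_eqF.
rewrite [Num.sqrt (c ^+ 2 * _)]sqrtrM ?sqr_ge0// sqrtr_sqr gtr0_norm// invfM mulrAC mulVf ?mul1r//.
by rewrite gt_eqF.
Unshelve. all: by end_near. Qed.

End NormalDensity.

(** * Generalised least squares and the joint density *)

Section Model.
Context {R : realType} (n r1 r2 : nat) (M : model R n r1 r2).
Hypothesis HM : model_assumptions M.

Local Notation Xt := (Xtheta M).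
Local Notation Xg := (Xgamma M).
Local Notation W := (invmx (Sigma M)).
Local Notation A := (theta_precision M).
Local Notation k := (limit_df M).

Definition gamma_precision : 'M[R]_r2 := Xg^T *m W *m Xg.
Local Notation G := gamma_precision.

Definition post_precision : 'M[R]_r1 := A + invmx (Omega M).
Local Notation P := post_precision.

(** The form that measures how far the estimate is from the prior mean 0: it is the
    precision of theta_hat under the prior predictive distribution, up to sigma^2. *)
Definition misfit : 'M[R]_r1 := invmx (invmx A + Omega M).

(** k times the squared scale of the Student posterior of theta. *)
Definition post_scale (y : 'cV[R]_n) : R :=
  s2_y M y + nu_prior M * s_prior M ^+ 2 + qform misfit (theta_hat M y).

Definition post_mean (y : 'cV[R]_n) : 'cV[R]_r1 :=
  invmx P *m A *m theta_hat M y.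

Lemma posdef_W : posdef W.
Proof. exact/posdef_invmx/(Sigma_posdef HM). Qed.

Lemma posdef_A : posdef A.
Proof.
have [rt _] := rank_row_mx_full (X_full_column_rank HM).
exact: posdef_congr posdef_W rt.
Qed.

Lemma posdef_G : posdef G.
Proof.
have [_ rg] := rank_row_mx_full (X_full_column_rank HM).
exact: posdef_congr posdef_W rg.
Qed.

Lemma posdef_P : posdef P.
Proof.
exact: posdefD posdef_A (posdef_invmx (Omega_posdef HM)).
Qed.

Lemma posdef_misfit : posdef misfit.
Proof.
exact: posdef_invmx (posdefD (posdef_invmx posdef_A) (Omega_posdef HM)).
Qed.

Lemma X_orthogonal_sym : Xg^T *m W *m Xt = 0.
Proof.
apply: trmx_inj; rewrite trmx0 -(X_orthogonal HM) !trmx_mul trmxK.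
by rewrite (proj1 posdef_W) mulmxA.
Qed.

Lemma gls_resid_theta y :
  Xt^T *m W *m (y - Xt *m theta_hat M y - Xg *m gamma_hat M y) = 0.
Proof.
have hE := gls_normal_eq y (posdef_unitmx posdef_A).
rewrite -/(theta_hat M y) in hE.
rewrite 2!mulmxBr [X in _ - X - _]mulmxA [X in _ - _ - X]mulmxA.
by rewrite (X_orthogonal HM) mul0mx subr0 hE subrr.
Qed.

Lemma gls_resid_gamma y :
  Xg^T *m W *m (y - Xt *m theta_hat M y - Xg *m gamma_hat M y) = 0.
Proof.
have hE := gls_normal_eq y (posdef_unitmx posdef_G).
rewrite -/(gamma_hat M y) in hE.
rewrite 2!mulmxBr [X in _ - X - _]mulmxA [X in _ - _ - X]mulmxA.
by rewrite X_orthogonal_sym mul0mx subr0 hE subrr.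
Qed.

(** Pythagoras for the form of Sigma^-1: the residual of the least squares fit is
    orthogonal to both column spaces, and these are orthogonal to each other. *)
Lemma qform_resid y theta gamma :
  qform W (y - (Xt *m theta + Xg *m gamma)) =
  s2_y M y + qform A (theta - theta_hat M y) + qform G (gamma - gamma_hat M y).
Proof.
pose e := y - Xt *m theta_hat M y - Xg *m gamma_hat M y.
pose t := theta_hat M y - theta; pose g := gamma_hat M y - gamma.
have -> : y - (Xt *m theta + Xg *m gamma) = e + (Xt *m t + Xg *m g).
  rewrite /e /t /g !mulmxBr.
  set a := Xt *m _; set b := Xg *m _; set c := Xt *m _; set d := Xg *m _.
  by apply/matrixP => i j; rewrite !mxE; ring.
have sW := proj1 posdef_W.
have e0 : bform W e (Xt *m t + Xg *m g) = 0.
  rewrite bformC// /bform trD !trmx_mul !mulmxDl -!mulmxA !(mulmxA _ W e).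
  by rewrite gls_resid_theta gls_resid_gamma !mulmx0 addr0 mxE.
have tg0 : bform W (Xt *m t) (Xg *m g) = 0.
  rewrite /bform trmx_mul -!mulmxA (mulmxA W) (mulmxA Xt^T) (mulmxA Xt^T).
  by rewrite (X_orthogonal HM) mul0mx mulmx0 mxE.
have qN (p : nat) (S : 'M[R]_p) (u v : 'cV[R]_p) : qform S (u - v) = qform S (v - u).
  by rewrite -(opprB u v) -[in RHS](scaleN1r (u - v)) qformZ sqrrN expr1n mul1r.
rewrite (qformD e _ sW) e0 (qformD (Xt *m t) _ sW) tg0 !mulr0 !addr0 addrA.
rewrite /s2_y -/e !qform_mulmx.
by rewrite /t /g (qN _ _ theta) (qN _ _ gamma).
Qed.

(** From n > r1 + r2 one gets more than positivity of the degrees of freedom, and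
    the excess is used: it makes the Student kernel dominated by a product of functions 1 / (1 + x_i^2). *)
Lemma limit_df_gt : r1%:R < k.
Proof.
rewrite /limit_df; have := n_large HM; rewrite -(ltr_nat R) natrD.
have := nu_prior_ge0 HM; lra.
Qed.

Lemma limit_df_gt0 : 0 < k.
Proof. exact: le_lt_trans (ler0n _ _) limit_df_gt. Qed.

Lemma post_scale_gt0 y : 0 < s2_y M y -> 0 < post_scale y.
Proof.
move=> s0; rewrite /post_scale -addrA ltr_wpDr// addr_ge0//.
  by rewrite mulr_ge0 ?sqr_ge0 ?(nu_prior_ge0 HM).
exact: posdef_ge0 posdef_misfit.
Qed.

Definition norm_const : R :=
  (Num.sqrt ((2 * pi) ^+ n * \det (Sigma M)))^-1 *
  (Num.sqrt ((2 * pi) ^+ r1 * \det (Omega M)))^-1.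

Lemma norm_const_gt0 : 0 < norm_const.
Proof.
rewrite mulr_gt0// invr_gt0 sqrtr_gt0 mulr_gt0//.
- by rewrite exprn_gt0// mulr_gt0// pi_gt0.
- exact: posdef_det_gt0 (Sigma_posdef HM).
- by rewrite exprn_gt0// mulr_gt0// pi_gt0.
- exact: posdef_det_gt0 (Omega_posdef HM).
Qed.

Lemma likelihood_priorE y theta gamma sig2 : 0 < sig2 ->
  likelihood M y theta gamma sig2 * prior M theta gamma sig2 =
  norm_const * sig2 `^ (- ((k + r1%:R) / 2 + r2%:R / 2) - 1) *
  expR (- ((post_scale y + qform P (theta - post_mean y)) / (2 * sig2))) *
  gauss_kernel G (gamma_hat M y) sig2 gamma.
Proof.
move=> s0; have spos := @gt_eqF _ _ _ _ s0.
rewrite /likelihood /prior /prior_theta.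
rewrite (mvnormal_pdf_scale _ _ (Sigma_posdef HM) s0).
rewrite (mvnormal_pdf_scale _ _ (Omega_posdef HM) s0).
rewrite /inv_chi2_kernel /gauss_kernel subr0 qform_resid /norm_const.
have -> : - ((k + r1%:R) / 2 + r2%:R / 2) - 1 =
    - (n%:R / 2) + - (r1%:R / 2) + (- (nu_prior M / 2) - 1).
  by rewrite /limit_df; field.
rewrite !powRD ?spos ?implybT//.
set c1 := (Num.sqrt _)^-1; set c2 := (Num.sqrt _)^-1.
set p1 := sig2 `^ _; set p2 := sig2 `^ _; set p3 := sig2 `^ _.
have cs := complete_square theta (theta_hat M y) posdef_A (Omega_posdef HM).
cbv zeta in cs; rewrite -/P -/misfit in cs.
set e1 := expR _; set e2 := expR _; set e3 := expR _.
set e4 := expR _; set e5 := expR _.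
suff e : e1 * e2 * e3 = e4 * e5 by rewrite -mulrA -mulrA -[RHS]mulrA -e; ring.
rewrite /e1 /e2 /e3 /e4 /e5 -!expRD; congr expR.
rewrite -!opprD -!mulrDl /post_scale /post_mean.
congr (- (_ / _)); move: cs.
set a := qform A _; set b := qform (invmx (Omega M)) _.
set c := qform P _; set d := qform misfit _ => cs.
lra.
Qed.

End Model.

(** * The posterior probability is a Student probability *)

Section Posterior.
Context {R : realType} (n r1 r2 : nat) (M : model R n r1 r2).
Hypothesis HM : model_assumptions M.

Local Notation k := (limit_df M).
Local Notation S := (limit_scale M).
Local Notation mass := (student_mass k S).
Local Notation T0 := (@Theta0 R r1).
Local Notation T1 := (@Theta1 R r1).

(** The location mu(y) of the Student distribution after rescaling. *)
Definition student_loc (y : 'cV[R]_n) : 'cV[R]_r1 :=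
  (Num.sqrt (post_scale M y / k))^-1 *: post_mean M y.

Let k0 : 0 < k := limit_df_gt0 HM.
Let r1k : r1%:R <= k := ltW (limit_df_gt HM).
Let pS : posdef (invmx S).
Proof. by rewrite invmxK; exact: posdef_P. Qed.

(** The constant C depends on y but not on A: this is what makes posterior
    probabilities and Bayes factors functions of the location only.  The weight w
    accommodates the renormalisation of the truncated priors; the integrand is
    constrained for sig2 > 0 only, because the prior probability of A is constant
    only there. *)
Lemma integral_paramsE y : 0 < s2_y M y ->
  exists2 C : R, 0 < C & forall w A f, 0 <= w -> cone A -> cVmeasurable_set A ->
    (forall theta gamma sig2, 0 < sig2 ->
      f theta gamma sig2 = w * (likelihood M y theta gamma sig2 *
        prior M theta gamma sig2 * \1_A theta)) ->
    integral_params f = w * C * mass A (student_loc y).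
Proof.
move=> s0.
have b1 : 1 <= (k + r1%:R) / 2.
  rewrite ler_pdivlMr// mul1r.
  have : (1 : R) <= r1%:R by rewrite ler1n; exact: r1_ge1 HM.
  by move=> h; rewrite (_ : 2 = 1 + 1)// lerD// (le_trans h).
have [C C0 hC] := mixture_integral (posdef_P HM) (posdef_G HM) k0 b1 r1k erefl
  (post_scale_gt0 HM s0).
exists (norm_const M * C) => [|w A f w0 cA mA fE].
  by rewrite mulr_gt0// (norm_const_gt0 HM).
rewrite (hC (w * norm_const M) A (post_mean M y) (gamma_hat M y))//.
- by rewrite -[w * _ * C]mulrA.
- by rewrite mulr_ge0// ltW// (norm_const_gt0 HM).
move=> theta gamma sig2 sig0; rewrite fE// (likelihood_priorE HM)//.
ring.
Qed.

Lemma mass_gt0 m : [/\ 0 < mass T0 m, 0 < mass T1 m & 0 < mass setT m].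
Proof.
have t0 : 0 < mass T0 m.
  apply: (@student_mass_gt0 _ _ _ _ k0 r1k pS _ _ (-1) 0) => //.
  - exact: cVmeasurable_Theta0.
  - exact: Theta0_box.
have t1 : 0 < mass T1 m.
  apply: (@student_mass_gt0 _ _ _ _ k0 r1k pS _ _ 1 2) => //.
  - by rewrite ltr1n.
  - exact: cVmeasurable_Theta1.
  - by move=> x; apply: Theta1_box; exact: r1_ge1 HM.
split=> //; rewrite -student_mass_setT// addr_gt0//.
Qed.

(** The exact identity behind all the claims: the posterior probability of a cone
    is a Student probability with a fixed shape and a location that depends on y. *)
Lemma posterior_probE y A : 0 < s2_y M y -> cone A -> cVmeasurable_set A ->
  posterior_prob M y A = mvstudent_prob k (student_loc y) S A.
Proof.
move=> /integral_paramsE[C C0 hC] cA mA.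
rewrite mvstudent_probE /posterior_prob (hC 1 A)//; last by move=> *; rewrite mul1r.
rewrite (hC 1 setT)//; last 2 first.
- exact: cVmeasurable_setT.
- by move=> *; rewrite mul1r indicT mulr1.
have [_ _ mT] := mass_gt0 (student_loc y).
by rewrite mul1r; field; rewrite !gt_eqF.
Qed.

(** Under the prior, theta / sigma has a distribution free of sigma, and a cone is
    invariant under division by sigma. *)
Lemma prior_prob_cst A (a b : R) : cone A -> cVmeasurable_set A -> a < b ->
  (forall x : 'cV[R]_r1, (forall i, a <= x i ord0 <= b) -> A x) ->
  exists2 c : R, 0 < c & forall sig2, 0 < sig2 -> prior_prob M A sig2 = c.
Proof.
move=> cA mA ab hA.
have [g g0 hg] := gauss_integral (posdef_invmx (Omega_posdef HM)) mA ab hA.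
pose c := (Num.sqrt ((2 * pi) ^+ r1 * \det (Omega M)))^-1.
have c0 : 0 < c.
  rewrite invr_gt0 sqrtr_gt0 mulr_gt0//.
    by rewrite exprn_gt0// mulr_gt0// pi_gt0.
  exact: posdef_det_gt0 (Omega_posdef HM).
exists (c * g) => [|sig2 s0]; first by rewrite mulr_gt0.
rewrite /prior_prob.
rewrite [X in integral_cV X](_ : _ = fun theta =>
  ((c * sig2 `^ (- (r1%:R / 2)))%:E *
   (gauss_kernel (invmx (Omega M)) 0 sig2 theta * \1_A theta)%:E)%E); last first.
  apply/funext => theta; rewrite /prior_theta.
  by rewrite (mvnormal_pdf_scale _ _ (Omega_posdef HM) s0) -EFinM mulrA.
rewrite integral_cVZl; last 3 first.
- by rewrite lee_fin mulr_ge0 ?powR_ge0// ltW.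
- exact: cVmeasurable_gauss.
- by move=> x; rewrite lee_fin gauss_ge0.
rewrite hg//; last first.
  by move=> x; rewrite add0r cone_indic// sqrtr_gt0.
rewrite -EFinM /= powRN -mulrA; congr (_ * _).
by rewrite mulKf// gt_eqF// powR_gt0.
Qed.

Lemma bayes_factorE : exists2 c : R, 0 < c & forall y, 0 < s2_y M y ->
  bayes_factor10 M y = c * (mass T1 (student_loc y) / mass T0 (student_loc y)).
Proof.
have [p0 p00 h0] : exists2 c : R, 0 < c & forall sig2, 0 < sig2 ->
    prior_prob M T0 sig2 = c.
  apply: (@prior_prob_cst _ (-1) 0) => //.
  - exact: cone_Theta0.
  - exact: cVmeasurable_Theta0.
  - exact: Theta0_box.
have [p1 p10 h1] : exists2 c : R, 0 < c & forall sig2, 0 < sig2 ->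
    prior_prob M T1 sig2 = c.
  apply: (@prior_prob_cst _ 1 2) => //.
  - exact: cone_Theta1.
  - exact: cVmeasurable_Theta1.
  - by rewrite ltr1n.
  - by move=> x; apply: Theta1_box; exact: r1_ge1 HM.
exists (p0 / p1) => [|y /integral_paramsE[C C0 hC]]; first by rewrite divr_gt0.
rewrite /bayes_factor10 /marginal_likelihood.
rewrite (hC p1^-1 T1)//; last 4 first.
- by rewrite invr_ge0 ltW.
- exact: cone_Theta1.
- exact: cVmeasurable_Theta1.
- by move=> theta gamma sig2 s0; rewrite /truncated_prior h1//; ring.
rewrite (hC p0^-1 T0)//; last 4 first.
- by rewrite invr_ge0 ltW.
- exact: cone_Theta0.
- exact: cVmeasurable_Theta0.
- by move=> theta gamma sig2 s0; rewrite /truncated_prior h0//; ring.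
have [m0 _ _] := mass_gt0 (student_loc y).
by field; rewrite !gt_eqF.
Qed.

(** The squared length of the location, in the form of the Student precision, is
    q (m(y)) / D(y).  Both m(y) and the last term of D(y) come from theta_hat, through
    a linear map and a positive definite form respectively, so the quotient is
    bounded by the comparison of quadratic forms. *)
Lemma shift_factor_loc_le : exists2 F : R, 1 <= F &
  forall y, 0 < s2_y M y -> shift_factor k S (student_loc y) <= F.
Proof.
pose N := invmx (post_precision M) *m theta_precision M.
have [c c0 hc] := qform_le_posdef (N^T *m invmx S *m N) (posdef_misfit HM).
pose b := (k + r1%:R) / 2.
have b0 : 0 <= b by rewrite divr_ge0// addr_ge0// ltW.
have c1 : 0 <= Num.sqrt c := sqrtr_ge0 _.
exists (((1 + Num.sqrt c) ^+ 2) `^ b) => [|y s0].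
  rewrite -[X in X <= _](powRr0 ((1 + Num.sqrt c) ^+ 2)); apply: ler_powR => //.
  by rewrite exprn_ege1// lerDl.
have D0 := post_scale_gt0 HM s0.
apply: ge0_ler_powR => //; rewrite ?nnegrE ?sqr_ge0//.
apply: lerXn2r; rewrite ?nnegrE ?addr_ge0 ?sqrtr_ge0//.
rewrite lerD2l ler_wsqrtr// /student_loc qformZ exprVn.
have Dk : 0 < post_scale M y / k by rewrite divr_gt0.
rewrite sqr_sqrtr ?(ltW Dk)// invf_div.
set q := qform _ _; rewrite (_ : _ / k = q / post_scale M y); last first.
  by field; rewrite !gt_eqF.
rewrite /q ler_pdivrMr// /post_mean -/N qform_mulmx.
apply: (le_trans (hc _)); rewrite ler_wpM2l ?(ltW c0)//.
rewrite /post_scale lerDr addr_ge0 ?(ltW s0)//.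
by rewrite mulr_ge0 ?sqr_ge0 ?(nu_prior_ge0 HM).
Qed.

Lemma mass_shift_le A m m' : cVmeasurable_set A ->
  mass A m <= shift_factor k S (m - m') * mass A m'.
Proof. exact: student_mass_shift_le. Qed.

Lemma mass_loc_bounds : exists2 F : R, 1 <= F & forall A y,
  cVmeasurable_set A -> 0 < s2_y M y ->
  mass A (student_loc y) <= F * mass A 0 /\ mass A 0 <= F * mass A (student_loc y).
Proof.
have [F F1 hF] := shift_factor_loc_le; exists F => // A y mA s0.
split; apply: (le_trans (mass_shift_le _ _ mA)); apply: ler_wpM2r;
  rewrite ?student_mass_ge0//.
  by rewrite subr0 hF.
by rewrite sub0r shift_factorN hF.
Qed.

(** Comparing with the location 0 bounds the probabilities of both cones below by
    positive constants, and they add up to 1. *)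
Lemma posterior_bounds : exists a b : R, [/\ 0 < a, a < b, b < 1 &
  forall y : 'cV[R]_n, 0 < s2_y M y -> a <= posterior_prob M y T0 <= b].
Proof.
have [F F1 hF] := mass_loc_bounds.
have [m0 m1 mT] := mass_gt0 0.
have F0 : 0 < F := lt_le_trans ltr01 F1.
set a := (F ^+ 2)^-1 * (mass T0 0 / mass setT 0).
set b := (F ^+ 2)^-1 * (mass T1 0 / mass setT 0).
have a0 : 0 < a by rewrite mulr_gt0 ?invr_gt0 ?exprn_gt0 ?divr_gt0.
have b0 : 0 < b by rewrite mulr_gt0 ?invr_gt0 ?exprn_gt0 ?divr_gt0.
have ab : a + b <= 1.
  rewrite -mulrDr -mulrDl student_mass_setT// mulfV ?gt_eqF// mulr1.
  by rewrite invf_le1 ?exprn_gt0// exprn_ege1.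
(* Halving makes the two bounds distinct even if F = 1, when a + b = 1. *)
exists (a / 2), (1 - b / 2); split; [lra|lra|lra|move=> y s0].
have [n0 n1 nT] := mass_gt0 (student_loc y).
have low A : cVmeasurable_set A -> (F ^+ 2)^-1 * (mass A 0 / mass setT 0) <=
    mass A (student_loc y) / mass setT (student_loc y).
  move=> mA; have [h1 h2] := hF A y mA s0.
  have [h3 h4] := hF setT y (@cVmeasurable_setT _ _) s0.
  have /andP[] // := ratio_bounds F0 nT mT (student_mass_ge0 _ _ _ _)
    (student_mass_ge0 _ _ _ _) h1 h2 h3 h4.
have la := low T0 (@cVmeasurable_Theta0 R r1).
have lb := low T1 (@cVmeasurable_Theta1 R r1).
rewrite posterior_probE//; last 2 first.
- exact: cone_Theta0.
- exact: cVmeasurable_Theta0.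
rewrite mvstudent_probE -/a in la *; rewrite -/b in lb.
set u := mass T0 (student_loc y) / _ in la *.
set v := mass T1 (student_loc y) / _ in lb.
have uv : u + v = 1 by rewrite -mulrDl student_mass_setT// mulfV// gt_eqF.
exact: half_lower_bounds a0 b0 la lb uv.
Qed.

End Posterior.

(** * Information inconsistency and the limit along a ray *)

Section Conclusion.
Context {R : realType} (n r1 r2 : nat) (M : model R n r1 r2).
Hypothesis HM : model_assumptions M.

Local Notation Xt := (Xtheta M).
Local Notation Xg := (Xgamma M).
Local Notation W := (invmx (Sigma M)).
Local Notation k := (limit_df M).
Local Notation S := (limit_scale M).
Local Notation mass := (student_mass k S).
Local Notation T0 := (@Theta0 R r1).
Local Notation T1 := (@Theta1 R r1).

(** The two orthogonality conditions are r1 + r2 < n linear equations in n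
    unknowns. *)
Lemma exists_residual : exists2 w : 'cV[R]_n, w != 0 &
  Xt^T *m W *m w = 0 /\ Xg^T *m W *m w = 0.
Proof.
pose B := col_mx (Xt^T *m W) (Xg^T *m W).
have : kermx B^T != 0.
  rewrite -mxrank_eq0 mxrank_ker -lt0n subn_gt0.
  exact: leq_ltn_trans (rank_leq_col _) (n_large HM).
move=> /rowV0Pn[v /sub_kermxP vB v0]; exists v^T.
  by rewrite -[0]trmx0 (inj_eq trmx_inj).
have : B *m v^T = 0 by apply: trmx_inj; rewrite trmx_mul trmxK vB trmx0.
rewrite mul_col_mx => h; split.
  by have := congr1 usubmx h; rewrite col_mxKu linear0.
by have := congr1 dsubmx h; rewrite col_mxKd linear0.
Qed.

(** The second half of consistency fails.  The data X_theta t_j + w, with w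
    orthogonal to the design and t_j the vector with all coordinates -j, have
    estimate t_j and constant residual, while the Bayes factor stays above a
    positive number. *)
Lemma information_inconsistentP : information_inconsistent M.
Proof.
move=> [_ h2].
have [w w0 [wt wg]] := exists_residual.
pose t j : 'cV[R]_r1 := const_mx (- j%:R).
pose y j : 'cV[R]_n := Xt *m t j + w.
have th j : theta_hat M (y j) = t j.
  rewrite /theta_hat /gls /y mulmxDr wt addr0 mulmxA mulKmx//.
  exact: posdef_unitmx (posdef_A HM).
have gh j : gamma_hat M (y j) = 0.
  by rewrite /gamma_hat /gls /y mulmxDr wg addr0 mulmxA (X_orthogonal_sym HM)
    mul0mx mulmx0.
have s2 j : s2_y M (y j) = qform W w.
  by rewrite /s2_y th gh mulmx0 subr0 /y addrC addKr.
have s0 j : 0 < s2_y M (y j) by rewrite s2; exact: (proj2 (posdef_W HM)).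
have hlim : bayes_factor10 M (y j) @[j --> \oo] --> (0 : R).
  apply: h2; first by split; [exact: s0|move=> j; rewrite !s2 !gh].
  move=> i; apply/cvgrNyPle => a; near=> j.
  rewrite th mxE lerNl; near: j; exact: nbhs_infty_ger.
have [c c0 hc] := bayes_factorE HM.
have [F F1 hF] := mass_loc_bounds HM.
have [m0 m1 _] := mass_gt0 HM 0.
have F0 := lt_le_trans ltr01 F1.
pose delta := c * (F ^- 2 * (mass T1 0 / mass T0 0)).
have d0 : 0 < delta.
  by rewrite mulr_gt0// mulr_gt0 ?invr_gt0 ?exprn_gt0// divr_gt0.
have low j : delta <= bayes_factor10 M (y j).
  rewrite hc// ler_wpM2l ?(ltW c0)//.
  have [n0 n1 _] := mass_gt0 HM (student_loc M (y j)).
  have [h3 h4] := hF T1 (y j) (@cVmeasurable_Theta1 R r1) (s0 j).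
  have [h5 h6] := hF T0 (y j) (@cVmeasurable_Theta0 R r1) (s0 j).
  by have /andP[] := ratio_bounds F0 n0 m0 (ltW n1) (ltW m1) h3 h4 h5 h6.
have : delta <= 0.
  rewrite -(cvg_lim _ hlim)//; apply: limr_ge; first exact: cvgP hlim.
  exact: nearW.
by rewrite leNgt d0.
Unshelve. all: by end_near. Qed.

(** Along a ray the location moves on a line, with the coefficient whose limit is
    given by cvg_scaled_ratio. *)
Lemma student_loc_line (v : 'cV[R]_r1) (c : R) (y : 'cV[R]_n) :
  theta_hat M y = c *: v ->
  student_loc M y =
    ((Num.sqrt ((s2_y M y + nu_prior M * s_prior M ^+ 2 +
                 c ^+ 2 * qform (misfit M) v) / k))^-1 * c) *:
    (S *m theta_precision M *m v).
Proof.
move=> hy; rewrite /student_loc /post_scale /post_mean hy qformZ.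
by rewrite -scalemxAr scalerA.
Qed.

Lemma limit_meanE v : limit_mean M v =
  (Num.sqrt (qform (misfit M) v / k))^-1 *: (S *m theta_precision M *m v).
Proof.
have k0 := limit_df_gt0 HM.
rewrite /limit_mean; congr (_^-1 *: _).
rewrite sqrtrM ?posdef_ge0//; last exact: posdef_misfit.
by rewrite sqrtrV ?(ltW k0)// mulrC powRN powR12_sqrt// ltW.
Qed.

Lemma posterior_limit (v : 'cV[R]_r1) (s2 : R) (y : R -> 'cV[R]_n) :
  v != 0 -> 0 < s2 ->
  (forall c : R, 0 < c -> theta_hat M (y c) = c *: v /\ s2_y M (y c) = s2) ->
  posterior_prob M (y c) T0 @[c --> +oo] -->
    mvstudent_prob k (limit_mean M v) S T0.
Proof.
move=> v0 s20 hy.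
have k0 := limit_df_gt0 HM.
have w0 : 0 < qform (misfit M) v by apply: (proj2 (posdef_misfit HM)).
have pS : posdef (invmx S) by rewrite invmxK; exact: posdef_P.
pose u := S *m theta_precision M *m v.
pose f c := ((Num.sqrt ((s2 + nu_prior M * s_prior M ^+ 2 +
                 c ^+ 2 * qform (misfit M) v) / k))^-1 * c) *: u.
have lim : mvstudent_prob k (f c) S T0 @[c --> +oo] -->
    mvstudent_prob k (limit_mean M v) S T0.
  apply: cvg_mvstudent_prob => //.
  - exact: ltW (limit_df_gt HM).
  - exact: cVmeasurable_Theta0.
  - by have [] := mass_gt0 HM (limit_mean M v).
  - by move=> c; have [] := mass_gt0 HM (f c).
  have e c : qform (invmx S) (f c - limit_mean M v) =
      ((Num.sqrt ((s2 + nu_prior M * s_prior M ^+ 2 +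
                 c ^+ 2 * qform (misfit M) v) / k))^-1 * c -
       (Num.sqrt (qform (misfit M) v / k))^-1) ^+ 2 * qform (invmx S) u.
    by rewrite limit_meanE -scalerBl qformZ.
  have ratio0 : (Num.sqrt ((s2 + nu_prior M * s_prior M ^+ 2 +
                 c ^+ 2 * qform (misfit M) v) / k))^-1 * c -
       (Num.sqrt (qform (misfit M) v / k))^-1 @[c --> +oo] --> (0 : R).
    rewrite -[X in _ --> X](subrr (Num.sqrt (qform (misfit M) v / k))^-1).
    by apply: cvgB; [exact: cvg_scaled_ratio|exact: cvg_cst].
  rewrite (funext e) -[X in _ --> X](mul0r (qform (invmx S) u)).
  apply: cvgM; last exact: cvg_cst.
  rewrite -[X in _ --> X](expr0n _ 2).
  exact: (continuous_cvg _ (@exprn_continuous R 2 0) ratio0).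
apply: cvg_trans lim; apply: near_eq_cvg; near=> c.
have c0 : 0 < c by near: c; exact: nbhs_pinfty_gt.
have [h1 h2] := hy c c0.
have s0 : 0 < s2_y M (y c) by rewrite h2.
rewrite (posterior_probE HM s0 (@cone_Theta0 R r1) (@cVmeasurable_Theta0 R r1)).
by rewrite (student_loc_line h1) h2.
Unshelve. all: by end_near. Qed.

End Conclusion.

Theorem lemma6 (R : realType) (n r1 r2 : nat) (M : model R n r1 r2)
    (HM : model_assumptions M) :
  (exists a b : R, [/\ 0 < a, a < b, b < 1 &
     forall y : 'cV[R]_n, 0 < s2_y M y ->
       a <= posterior_prob M y (@Theta0 R r1) <= b]) /\
  information_inconsistent M /\
  (forall (v : 'cV[R]_r1) (s2 : R) (y : R -> 'cV[R]_n),
     v != 0 -> 0 < s2 ->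
     (forall c : R, 0 < c -> theta_hat M (y c) = c *: v /\ s2_y M (y c) = s2) ->
     posterior_prob M (y c) (@Theta0 R r1) @[c --> +oo] -->
       mvstudent_prob (limit_df M) (limit_mean M v) (limit_scale M)
         (@Theta0 R r1)).
Proof.
split; first exact: posterior_bounds.
split; first exact: information_inconsistentP.
exact: posterior_limit.
Qed.
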